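(* Let $M\subseteq\mathcal B(H)$ and $N\subseteq\mathcal B(K)$ be von Neumann algebras. For a normal $*$-homomorphism $\theta\colon N\to M$ (not assumed unital) set $$V^\theta=\{v\in\mathcal B(H,K): yv=v\theta(y)\ \ (y\in N)\}.$$ Then $\theta\mapsto V^\theta$ is a bijection between normal $*$-homomorphisms $\theta\colon N\to M$ and coinjective quantum relations $V$ from $M$ to $N$. Under this bijection, with $V=V^\theta$: (1) unital homomorphisms correspond to quantum functions; (2) injective homomorphisms correspond to surjective quantum relations; (3) $V$ is injective if and only if $\theta(1)$ is central in $M$ and $\theta(N)=\theta(1)M$; (4) for quantum functions, surjective homomorphisms correspond to injective quantum functions.
   Context: Von Neumann algebras $M\subseteq\mathcal B(H)$ contain the identity of $\mathcal B(H)$; $M'$ denotes the commutant. Homomorphisms are not assumed unital unless stated. A quantum relation from $M\subseteq\mathcal B(H)$ to $N\subseteq\mathcal B(K)$ is a weak$^*$-closed subspace $V\subseteq\mathcal B(H,K)$ which is an $N'$-$M'$-bimodule: $axb\in V$ whenever $x\in V$, $a\in N'$, $b\in M'$. Put $V^*=\{v^*:v\in V\}\subseteq\mathcal B(K,H)$, a quantum relation from $N$ to $M$. Composition of quantum relations is $V\circ W=\overline{\mathrm{lin}}^{\,w^*}\{vw: v\in V,w\in W\}$ (weak$^*$-closed linear span). A quantum relation $V$ from $M$ to $N$ is: coinjective if $V\circ V^*\subseteq N'$; cosurjective if $V^*\circ V\supseteq M'$; injective if $V^*\circ V\subseteq M'$; surjective if $V\circ V^*\supseteq N'$; a (quantum)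 function if it is both coinjective and cosurjective. *)

(* Defs.v *)
From HB Require Import structures.
From mathcomp Require Import all_boot all_order all_algebra.
From mathcomp Require Import complex.
From mathcomp Require Import all_classical all_reals all_analysis.

Set Implicit Arguments.
Unset Strict Implicit.
Unset Printing Implicit Defensive.

Import Order.TTheory GRing.Theory Num.Theory.
Import numFieldNormedType.Exports.

Local Open Scope classical_set_scope.
Local Open Scope ring_scope.

(* [R[i]] seen as a [numClosedFieldType], so that the topology that
   MathComp-Analysis puts on every [numFieldType] is found on it. *)
Definition CC (R : realType) : numClosedFieldType := R[i].

(* Library convention: [inner] is linear in its first argument and
   conjugate-linear in its second one. *)
HB.mixin Record isHilbert (R : realType) H
    of CompleteNormedModule (CC R) H := {
  inner : {dot H for (@Num.conj (CC R))} ;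
  inner_norm : forall x : H, inner x x = `|x| ^+ 2 }.

#[short(type="hilbertType")]
HB.structure Definition Hilbert (R : realType) :=
  {H of isHilbert R H & CompleteNormedModule (CC R) H}.

Section BoundedOperators.
Context (R : realType).
Implicit Types H K L : hilbertType R.

Definition bounded_op H K : {pred H -> K} := fun f =>
  `[< linear f /\ exists k : CC R, forall x, `|f x| <= k * `|x| >].

Lemma bounded_op_submod H K : submod_closed (@bounded_op H K).
Proof.
split=> [|a f g /asboolP[lf [k kf]] /asboolP[lg [l lg']]]; apply/asboolP; split.
- by move=> a x y; rewrite /= scaler0 addr0.
- by exists 0 => x; rewrite /= normr0 mul0r.
- move=> b x y; rewrite !fctE lf lg !scalerDr !scalerA (mulrC b a).
  by rewrite -!addrA; congr (_ + _); rewrite addrCA.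
- exists (`|a| * k + l) => x; rewrite !fctE mulrDl (le_trans (ler_normD _ _))//.
  by rewrite lerD// normrZ -mulrA ler_wpM2l.
Qed.

HB.instance Definition _ H K :=
  GRing.isSubmodClosed.Build (CC R) (H -> K) (@bounded_op H K)
    (@bounded_op_submod H K).

Record bop H K := Bop { bop_fun :> H -> K ; bop_funP : bop_fun \in @bounded_op H K }.

HB.instance Definition _ H K := [isSub for @bop_fun H K].
HB.instance Definition _ H K := [Choice of bop H K by <:].
HB.instance Definition _ H K := [SubChoice_isSubLmodule of bop H K by <:].

Lemma bop_id_subproof H : (idfun : H -> H) \in @bounded_op H H.
Proof. by apply/asboolP; split=> //; exists 1 => x; rewrite mul1r. Qed.

Definition bop_id H : bop H H := Bop (bop_id_subproof H).

Lemma bop_comp_subproof H K L (g : bop K L) (f : bop H K) :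
  (g \o f : H -> L) \in @bounded_op H L.
Proof.
case: f g => [f /asboolP[lf [k kf]]] [g /asboolP[lg [l lg']]] /=.
apply/asboolP; split=> [a x y|]; first by rewrite /= lf lg.
exists (`|l| * k) => x /=; apply: (le_trans (lg' _)).
have [->|fx0] := eqVneq (f x) 0.
  rewrite normr0 mulr0 -mulrA mulr_ge0//.
  exact: le_trans (kf x).
rewrite -mulrA; apply: le_trans (ler_wpM2l (normr_ge0 l) (kf x)).
apply: ler_wpM2r => //.
have l0 : 0 <= l.
  have := le_trans (normr_ge0 _) (lg' (f x)).
  by rewrite pmulr_lge0// normr_gt0.
by rewrite ger0_norm.
Qed.

Definition bop_comp H K L (g : bop K L) (f : bop H K) : bop H L :=
  Bop (bop_comp_subproof g f).

(* The adjoint exists (Riesz) and is unique, so the default value [0] is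
   never used. *)
Definition adj H K (x : bop H K) : bop K H :=
  xget (0 : bop K H) [set y : bop K H | forall (h : H) (k : K), inner (x h) k = inner h (y k)].

Definition square_summable H : set (nat -> H) :=
  [set xi | cvgn (series (fun n => `|xi n| ^+ 2 : CC R))].

(* Index type of the normal functionals on B(H,K): the trace-class operators
   are exactly the sums of the rank-one operators given by a pair of
   square-summable sequences. *)
Definition predual_index H K : Type :=
  set_type ((@square_summable H) `*` (@square_summable K)).

Definition predual_pairing H K (x : bop H K) (p : predual_index H K) : CC R :=
  limn (series (fun n => inner (x ((\val p).1 n)) ((\val p).2 n) : CC R)).

(* The canonical topology of [bop H K] is the weak* (ultraweak) one, not the
   norm topology. *)
HB.instance Definition _ H K := Topological.copy (bop H K)
  (initial_topology (@predual_pairing H K : bop H K ->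
     {ptws predual_index H K -> CC R})).

End BoundedOperators.

Notation "''B' ( H , K )" := (bop H K)
  (at level 8, format "''B' ( H ,  K )") : type_scope.
Infix "\ob" := bop_comp (at level 40, left associativity) : ring_scope.

Section QuantumRelations.
Context (R : realType).
Implicit Types H K L : hilbertType R.

Definition subspace_set H K : set (set 'B(H, K)) := [set V |
  V 0 /\ forall (a : CC R) x y, V x -> V y -> V (a *: x + y)].

Definition commutant H (M : set 'B(H, H)) : set 'B(H, H) :=
  [set a | forall b, M b -> a \ob b = b \ob a].

Structure vonNeumannAlgebra H := VonNeumannAlgebra {
  vN_set :> set 'B(H, H) ;
  vN_idP : vN_set (bop_id H) ;
  vN_linP : forall (a : CC R) x y,
    vN_set x -> vN_set y -> vN_set (a *: x + y) ;
  vN_mulP : forall x y, vN_set x -> vN_set y -> vN_set (x \ob y) ;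
  vN_adjP : forall x, vN_set x -> vN_set (adj x) ;
  vN_closedP : closed vN_set }.

Section Operations.
Context H (M : vonNeumannAlgebra H).
Definition vN_id : M := SigSub (mem_set (vN_idP M)).
Definition vN_lin (a : CC R) (x y : M) : M :=
  SigSub (mem_set (vN_linP a (set_valP x) (set_valP y))).
Definition vN_mul (x y : M) : M :=
  SigSub (mem_set (vN_mulP (set_valP x) (set_valP y))).
Definition vN_adj (x : M) : M := SigSub (mem_set (vN_adjP (set_valP x))).
End Operations.

(* Continuity is for the weak* topologies that [N] and [M] inherit from
   B(K,K) and B(H,H). *)
Definition normal_star_hom H K (N : vonNeumannAlgebra K)
    (M : vonNeumannAlgebra H) : set (N -> M) := [set theta |
  [/\ forall a x y, theta (vN_lin a x y) = vN_lin a (theta x) (theta y),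
      forall x y, theta (vN_mul x y) = vN_mul (theta x) (theta y),
      forall x, theta (vN_adj x) = vN_adj (theta x) &
      continuous theta]].

Definition unital H K (N : vonNeumannAlgebra K) (M : vonNeumannAlgebra H)
    (theta : N -> M) := theta (vN_id N) = vN_id M.

Definition quantum_relation H K (M : vonNeumannAlgebra H)
    (N : vonNeumannAlgebra K) : set (set 'B(H, K)) := [set V |
  [/\ subspace_set V, closed V &
      forall a x b, commutant N a -> V x -> commutant M b ->
        V (a \ob x \ob b)]].

Definition qadj H K (V : set 'B(H, K)) : set 'B(K, H) := @adj R H K @` V.

Definition qcomp H K L (V : set 'B(K, L)) (W : set 'B(H, K)) : set 'B(H, L) :=
  closure (smallest (@subspace_set H L) [set v \ob w | v in V & w in W]).

Section Properties.
Context H K (M : vonNeumannAlgebra H) (N : vonNeumannAlgebra K).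
Implicit Type V : set 'B(H, K).

Definition coinjective V := qcomp V (qadj V) `<=` commutant N.
Definition cosurjective V := commutant M `<=` qcomp (qadj V) V.
Definition qinjective V := qcomp (qadj V) V `<=` commutant M.
Definition qsurjective V := commutant N `<=` qcomp V (qadj V).
Definition quantum_function V :=
  [/\ quantum_relation M N V, coinjective V & cosurjective V].

Definition intertwiners (theta : N -> M) : set 'B(H, K) :=
  [set v | forall y : N, \val y \ob v = v \ob \val (theta y)].
End Properties.

End QuantumRelations.

(* Main.v *)
Require Import Defs.
From HB Require Import structures.
From mathcomp Require Import all_boot all_order all_algebra.
From mathcomp Require Import complex.
From mathcomp Require Import all_classical all_reals all_analysis.
From mathcomp Require Import ring.

(** Taking adjoints turns y v = v theta(y) into theta(y) v* = v* y.  So the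
    intertwiners V of theta determine theta on V* K, and the question is what
    happens on the orthogonal complement of V* K, the common kernel of V.  If
    theta is normal it vanishes there, because normality provides enough
    intertwiners ([intertwiners_separate]); hence V determines theta
    ([intertwiners_inj]).  Coinjectivity is the computation
    y v w* = v theta(y) w* = v w* y.

    Conversely, a coinjective V yields a homomorphism through the formula
    theta(y) v* k = v* y k, extended by 0 to the common kernel of V
    ([relation_symbol]).  The operators u v* commute with y, which makes y* y
    symmetric for the inner products of the vectors v* k; a log-convexity
    argument then bounds theta(y) by a constant depending on y alone.  Since V
    is stable under M', the operator theta(y) commutes with M', so it belongs
    to M by the double commutant theorem ([double_commutant]).  The algebraic
    rules are checked on V* K and on the common kernel ([bop_ext_star]).  For
    normality, [exhaustion] finds v_i in V such that the sum of the v_i* v_i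
    acts on a given sequence of vectors as the projection onto the complement
    of the common kernel; then
    |theta(y) xi|^2 = <xi, theta(y* y) xi> = sum <v_i xi, v_i theta(y* y) xi>,
    which is sum |y v_i xi|^2, and a map dominated in this way is weak*
    continuous ([normal_continuous]).  Finally an intertwiner x of theta satisfies
    x = x theta(1), and theta(1) is a limit of elements of span (V* V)
    ([star_span_approx]), so x is a limit of elements of
    x V* V, contained in N' V and hence in V ([symbol_intertwiners]).

    All topological arguments take place in the Hilbert space l2 H of square
    summable sequences.  A normal functional on B(H,K) is
    x |-> <(1 (x) x) xi, eta> with xi in l2 H and eta in l2 K, so weak*
    density follows from approximation of (1 (x) x) xi in norm
    ([closure_ultrastrong]), and a weak* continuous functional f satisfies
    |f(y* y)| <= |(1 (x) y) zeta|^2 for one zeta ([weakstar_dominated]).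

    As for the four properties: v theta(1) = v on V, and span (V* V)
    approximates theta(1), so V* V generates a space containing M' exactly
    when theta(1) = 1 ([unital_quantum_function]).  The projection onto the
    common kernel of V* lies in N and is annihilated by theta, so it vanishes
    when theta is injective, and then span (V V* ) is dense in N'
    ([injective_qsurjective]).  If V* V lies in M', then V* is coinjective from
    N to M, and its symbol sends m in M to some y in N with y v = v m, that is,
    theta(y) = theta(1) m ([qinjectiveP]).  The last property is the unital
    case of this one. *)

Set Implicit Arguments.
Unset Strict Implicit.
Unset Printing Implicit Defensive.

Import Order.TTheory GRing.Theory Num.Theory.
Import numFieldNormedType.Exports.

Local Open Scope classical_set_scope.
Local Open Scope ring_scope.

(** * Hilbert space geometry *)

Section DotForm.
Context (C : numClosedFieldType) (U : lmodType C) (f : {dot U for Num.conj}).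

Lemma form_conj x y : f y x = (f x y)^*.
Proof. by rewrite hermC expr0 mul1r. Qed.

Lemma dotZl a x y : f (a *: x) y = a * f x y.
Proof. exact: linearZl_LR. Qed.

Lemma dotZr a x y : f x (a *: y) = a^* * f x y.
Proof. exact: linearZr_LR. Qed.

(** Positivity of the form at [f y y *: x - f x y *: y], which is [f y y] times
    the component of x orthogonal to y. *)
Lemma form_cauchy_schwarz x y : `|f x y| ^+ 2 <= f x x * f y y.
Proof.
have [->|y0] := eqVneq y 0; first by rewrite !linear0r normr0 expr0n.
have fy0 : 0 < f y y by rewrite dnorm_gt0.
have fyN : f y y != 0 by rewrite gt_eqF.
have : 0 <= f (f y y *: x - f x y *: y) (f y y *: x - f x y *: y) by [].
rewrite linearBl !linearBr /= !dotZl !dotZr (form_conj x y).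
rewrite (CrealP (ger0_real (ltW fy0))).
set a := f x y; set b := f y y; set c := f x x.
have -> : b * (b * c) - b * (a^* * a) - (a * (b * a^*) - a * (a^* * b)) =
  b * (c * b - a * a^*) by ring.
by rewrite pmulr_rge0// subr_ge0 normCK.
Qed.

End DotForm.

Section HilbertBasics.
Context (R : realType).
Implicit Types H K : hilbertType R.

Lemma innerxx_ge0 H (x : H) : 0 <= inner x x.
Proof. by []. Qed.

Lemma innerBl H (x y z : H) : inner (x - y) z = inner x z - inner y z.
Proof. exact: linearBl. Qed.

Lemma innerPl H (a : CC R) (x y z : H) :
  inner (a *: x + y) z = a * inner x z + inner y z.
Proof. exact: linearPl. Qed.

Lemma inner0l H (z : H) : inner 0 z = 0.
Proof. exact: linear0l. Qed.

Lemma inner0r H (z : H) : inner z 0 = 0.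
Proof. exact: linear0r. Qed.

Lemma inner_normM H (x y : H) : `|inner x y| <= `|x| * `|y|.
Proof.
rewrite -(@ler_pXn2r _ 2)// ?nnegrE ?mulr_ge0// exprMn -!inner_norm.
exact: form_cauchy_schwarz.
Qed.

Lemma inner_eq0 H (x : H) : inner x x = 0 -> x = 0.
Proof. by move=> /eqP; rewrite inner_norm expf_eq0/= normr_eq0 => /eqP. Qed.

Lemma inner_ext H (x y : H) : (forall z, inner x z = inner y z) -> x = y.
Proof.
move=> xy; apply/eqP; rewrite -subr_eq0; apply/eqP/inner_eq0.
by rewrite linearBl /= xy subrr.
Qed.

Lemma inner_extr H (x y : H) : (forall z, inner z x = inner z y) -> x = y.
Proof.
by move=> xy; apply: inner_ext => z; rewrite (form_conj _ z) xy -form_conj.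
Qed.

Lemma parallelogram H (x y : H) :
  `|x - y| ^+ 2 = `|x| ^+ 2 *+ 2 + `|y| ^+ 2 *+ 2 - `|x + y| ^+ 2.
Proof.
by rewrite -!inner_norm linearBl !linearBr linearDl !linearDr /=; ring.
Qed.

Lemma small_eq0 (a : CC R) (c : CC R) :
  (forall e, 0 < e -> `|a| <= e * c) -> a = 0.
Proof.
move=> h; apply/eqP; rewrite -normr_eq0 -[_ == _]negbK; apply/negP => a0.
have a_gt0 : 0 < `|a| by rewrite lt_neqAle eq_sym a0/=.
have c0 : 0 < c by have := lt_le_trans a_gt0 (h _ ltr01); rewrite mul1r.
have := h (`|a| / (c *+ 2)); rewrite divr_gt0 ?pmulrn_lgt0// => /(_ isT).
rewrite -mulr_natr invfM mulrA mulrAC divfK ?gt_eqF//.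
rewrite -subr_ge0 -{2}(mulr1 `|a|) -mulrBr pmulr_rge0// subr_ge0.
by rewrite invf_ge1 ?ltr0n// lern1.
Qed.

Lemma small_le (a b c : CC R) : a \is Num.real -> b \is Num.real ->
  (forall e, 0 < e -> a <= b + e * c) -> a <= b.
Proof.
move=> ar br h; have [//|ba] := real_leP ar br.
suff ab0 : a - b = 0 by move: ba; rewrite (subr0_eq ab0) ltxx.
apply: (@small_eq0 _ c) => e e0.
by rewrite gtr0_norm ?subr_gt0// lerBlDl h.
Qed.

Lemma closure_normP H (A : set H) z :
  closure A z <-> forall e : CC R, 0 < e -> exists2 a, A a & `|z - a| < e.
Proof.
split=> [Az e e0|h B].
  have [|a [Aa za]] := Az (ball z e); first exact: nbhsx_ballx.
  by exists a => //; rewrite -ball_normE in za.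
move=> /nbhs_ballP[e /= e0 eB]; have [a Aa za] := h e e0.
by exists a; split=> //; apply: eB; rewrite -ball_normE.
Qed.

Lemma closure_inner_eq0 H (A : set H) z y :
  closure A z -> (forall a, A a -> inner a y = 0) -> inner z y = 0.
Proof.
move=> /closure_normP Az Ay; apply: (@small_eq0 _ `|y|) => e /Az[a /Ay ay ze].
rewrite -[X in `|X|]subr0 -ay -linearBl /= (le_trans (inner_normM _ _))//.
by rewrite ler_wpM2r// ltW.
Qed.

Lemma closure_inner_le H (A : set H) z y (c : CC R) : 0 <= c ->
  closure A z -> (forall a, A a -> `|inner a y| <= c * `|a|) ->
  `|inner z y| <= c * `|z|.
Proof.
move=> c0 /closure_normP Az Ay; apply: (@small_le _ _ (`|y| + c)).
- exact: normr_real.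
- by rewrite ger0_real// mulr_ge0.
move=> e e0; have [a Aa za] := Az e e0.
have -> : inner z y = inner (z - a) y + inner a y.
  by rewrite linearBl /= subrK.
have -> : c * `|z| + e * (`|y| + c) = e * `|y| + c * (`|z| + e) by ring.
rewrite (le_trans (ler_normD _ _))// lerD//.
  by rewrite (le_trans (inner_normM _ _))// ler_wpM2r// ltW.
rewrite (le_trans (Ay _ Aa))// ler_wpM2l//.
have -> : a = z + (a - z) by rewrite addrC subrK.
by rewrite (le_trans (ler_normD _ _))// lerD// distrC ltW.
Qed.

(** The order of the complex numbers is partial: infima and monotone limits are
    taken in [R] and carried over by the next two maps. *)
Definition re_part (z : CC R) : R := complex.Re (z : R[i]).
Definition of_real (r : R) : CC R := (r%:C)%C.

Lemma re_partK z : z \is Num.real -> of_real (re_part z) = z.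
Proof. exact: RRe_real. Qed.

Lemma ler_of_real r s : (of_real r <= of_real s) = (r <= s).
Proof. exact: lecR. Qed.

Lemma ltr_of_real r s : (of_real r < of_real s) = (r < s).
Proof. exact: ltcR. Qed.

Lemma of_realD r s : of_real (r + s) = of_real r + of_real s.
Proof. exact: rmorphD. Qed.

Lemma of_realM r s : of_real (r * s) = of_real r * of_real s.
Proof. exact: rmorphM. Qed.

Lemma of_realX r n : of_real (r ^+ n) = of_real r ^+ n.
Proof. exact: rmorphXn. Qed.

Lemma real_infimum (S : Type) (q : S -> CC R) (b : CC R) :
  (exists s : S, True) -> b \is Num.real -> (forall s, b <= q s) ->
  exists m, (forall s, m <= q s) /\ forall e, 0 < e -> exists s, q s < m + e.
Proof.
move=> [s0 _] b_real bq.
have q_real s : q s = of_real (re_part (q s)).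
  by rewrite re_partK// -(ler_real (bq s)).
pose A := [set re_part (q s) | s in [set: S]].
have A0 : has_inf A.
  split; first by exists (re_part (q s0)), s0.
  exists (re_part b) => _ [s _ <-]; have := bq s.
  by rewrite -(re_partK b_real) (q_real s) ler_of_real.
exists (of_real (inf A)); split=> [s|e e0].
  by rewrite q_real ler_of_real; apply: ge_inf; [case: A0|exists s].
have eE : of_real (re_part e) = e by rewrite re_partK// gtr0_real.
have e0' : 0 < re_part e by rewrite -ltr_of_real eE.
have [_ [s _ <-] hs] := inf_adherent e0' A0.
by exists s; rewrite q_real -eE -of_realD ltr_of_real.
Qed.

End HilbertBasics.

Arguments re_part {R}.
Arguments of_real {R}.

(** * Riesz representation *)

Section Riesz.
Context (R : realType) (H : hilbertType R) (S : Type).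
Variables (T : S -> H) (phi : S -> CC R) (c : CC R).
Hypotheses (S0 : exists s : S, True) (c_ge0 : 0 <= c)
  (linTphi : forall a s t, exists u,
     T u = a *: T s + T t /\ phi u = a * phi s + phi t)
  (bnd_phi : forall s, `|phi s| <= c * `|T s|).

Let energy s := inner (T s) (T s) - (phi s + (phi s)^*).

Let energy_ge s : - (c ^+ 2) <= energy s.
Proof.
have h : phi s + (phi s)^* <= (c * `|T s|) *+ 2.
  have -> : phi s + (phi s)^* = 'Re (phi s) *+ 2.
    by rewrite mulr2n ReE -splitr.
  by rewrite lerMn2r/= (le_trans (leif_Re_Creal _).1)// (le_trans (bnd_phi s)).
rewrite /energy inner_norm lerBrDr (le_trans (lerD (lexx _) h))//.
rewrite addrC -subr_ge0.
have -> : `|T s| ^+ 2 - ((c * `|T s|) *+ 2 - c ^+ 2) = (`|T s| - c) ^+ 2.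
  by ring.
by rewrite real_exprn_even_ge0// rpredB// ger0_real.
Qed.

Let combD s t : exists u, T u = T s + T t /\ phi u = phi s + phi t.
Proof. by have := linTphi 1 s t; rewrite scale1r mul1r. Qed.

Let combZ a s : exists u, T u = a *: T s /\ phi u = a * phi s.
Proof.
have [z [Tz fz]] := linTphi (-1) s s.
have [u [Tu fu]] := linTphi a s z; exists u.
by rewrite Tu fu Tz fz scaleN1r mulN1r !addNr !addr0.
Qed.

(* The parallelogram identity at T s and T t, with the energy of the midpoint
   bounded below by m. *)
Let energy_gap m s t : (forall s, m <= energy s) ->
  `|T s - T t| ^+ 2 <= (energy s - m) *+ 2 + (energy t - m) *+ 2.
Proof.
move=> m_le; have [v [Tv fv]] := combD s t; have [u [Tu fu]] := combZ 2^-1 v.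
rewrite parallelogram -subr_ge0.
suff <- : (energy u - m) *+ 4 = (energy s - m) *+ 2 + (energy t - m) *+ 2 -
    (`|T s| ^+ 2 *+ 2 + `|T t| ^+ 2 *+ 2 - `|T s + T t| ^+ 2).
  by rewrite mulrn_wge0// subr_ge0.
rewrite /energy Tu fu Tv fv !dotZl !dotZr !inner_norm !rmorphM !rmorphD /=.
by rewrite fmorphV rmorph_nat; field.
Qed.

(* Compares s with the point of least energy on the line through s in the
   direction t. *)
Let energy_slope m e s t : (forall s, m <= energy s) -> energy s < m + e ^+ 2 ->
  0 < e -> `|inner (T t) (T s) - phi t| <= e * `|T t|.
Proof.
move=> m_le se e0; have [Tt0|Tt0] := eqVneq (T t) 0.
  have : `|phi t| <= 0 by rewrite (le_trans (bnd_phi t))// Tt0 normr0 mulr0.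
  by rewrite Tt0 linear0l sub0r normrN normr0 mulr0.
set w := inner (T t) (T s) - phi t.
have t0 : 0 < `|T t| ^+ 2 by rewrite exprn_gt0// normr_gt0.
have [u [Tu fu]] := linTphi (- w^* / `|T t| ^+ 2) t s.
have : m <= energy s - `|w| ^+ 2 / `|T t| ^+ 2.
  suff <- : energy u = energy s - `|w| ^+ 2 / `|T t| ^+ 2 by exact: m_le.
  rewrite /energy Tu fu linearDl !linearDr /= !dotZl !dotZr.
  rewrite (inner_norm (T t)) (form_conj _ (T t) (T s)).
  rewrite !(rmorphM, rmorphD, rmorphN, fmorphV, rmorphXn)/= conjCK normCK.
  rewrite (CrealP (normr_real _)) /w !rmorphB /=.
  by field; rewrite normr_eq0.
rewrite lerBrDr => /le_lt_trans/(_ se); rewrite ltrD2l ltr_pdivrMr//.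
rewrite -exprMn => /ltW; rewrite ler_pXn2r// ?nnegrE ?mulr_ge0// ltW//.
Qed.

(** Minimising the energy |T s|^2 - 2 Re (phi s): a minimising sequence is
    Cauchy by the parallelogram law, and the derivative of the energy vanishes
    at its limit.  Indexing by [S] instead of by a subspace covers at once
    functionals on a subspace, orthogonal projections and extension by
    continuity. *)
Lemma riesz_representation :
  exists2 z, closure (range T) z & forall s, phi s = inner (T s) z.
Proof.
have [|m [m_le m_inf]] := real_infimum S0 _ energy_ge.
  by rewrite rpredN ger0_real// exprn_ge0.
(* The sublevel sets of the energy generate a Cauchy filter. *)
pose F := filter_from [set e : CC R | 0 < e]
  (fun e => [set T s | s in [set s | energy s < m + e]]).
have F_filter : ProperFilter F.
  apply: filter_from_proper; last by move=> e /m_inf[s se]; exists (T s), s.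
  apply: filter_from_filter; first by exists 1; exact: ltr01.
  move=> d e d0 e0; have dr := gtr0_real d0; have er := gtr0_real e0.
  have [de|/ltW ed] := real_leP dr er; [exists d|exists e] => //.
    by move=> _ [s /= se <-]; split; exists s => //=; rewrite (lt_le_trans se)// lerD2l.
  by move=> _ [s /= se <-]; split; exists s => //=; rewrite (lt_le_trans se)// lerD2l.
have F_in e : 0 < e -> F [set T s | s in [set s | energy s < m + e ^+ 2]].
  by move=> e0; exists (e ^+ 2) => //=; rewrite exprn_gt0.
have F_cauchy : cauchy F.
  apply: cauchy_exP => e e0; have e2 : 0 < e / 2 by rewrite divr_gt0.
  have /filter_ex[_ [s /= se _]] := F_in _ e2.
  exists (T s); apply: filterS (F_in _ e2) => _ [t /= te <-].
  rewrite -ball_normE /ball_/= -(@ltr_pXn2r _ 2)// ?nnegrE//; last exact: ltW.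
  rewrite (le_lt_trans (energy_gap s t m_le))//.
  have -> : e ^+ 2 = ((e / 2) ^+ 2) *+ 2 + ((e / 2) ^+ 2) *+ 2 by field.
  by rewrite ltrD// ltrMn2r/= ltrBlDl.
have F_cvg := cauchy_cvg F F_cauchy; pose z := lim F.
have F_limit e : 0 < e -> exists s, energy s < m + e ^+ 2 /\ `|z - T s| < e.
  move=> e0; have Fz : F (ball z e) by apply: F_cvg; exact: nbhsx_ballx.
  have [y [[s se <-] zs]] := filter_ex (filterI (F_in _ e0) Fz).
  by exists s; rewrite -ball_normE in zs.
exists z.
  by apply/closure_normP => e /F_limit[s [_ zs]]; exists (T s) => //; exists s.
move=> t; apply/eqP; rewrite eq_sym -subr_eq0; apply/eqP.
apply: (@small_eq0 _ _ (`|T t| *+ 2)) => e e0.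
have [s [se zs]] := F_limit e e0.
have -> : inner (T t) z - phi t =
    inner (T t) (z - T s) + (inner (T t) (T s) - phi t).
  by rewrite linearBr /= addrA subrK.
rewrite mulrnAr mulr2n (le_trans (ler_normD _ _))// lerD//; last first.
  exact: energy_slope m_le se e0.
by rewrite (le_trans (inner_normM _ _))// mulrC ler_wpM2r// ltW.
Qed.

End Riesz.

(** * Adjoints and extension of operators *)

Section Operators.
Context (R : realType).
Implicit Types H K L : hilbertType R.

Lemma bop_linear H K (x : 'B(H, K)) : linear x.
Proof. by have /asboolP[] := bop_funP x. Qed.

HB.instance Definition _ H K (x : 'B(H, K)) :=
  GRing.isLinear.Build (CC R) H K _ (bop_fun x) (bop_linear x).

Lemma bop_bound H K (x : 'B(H, K)) :
  exists2 c : CC R, 0 <= c & forall h, `|x h| <= c * `|h|.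
Proof.
have /asboolP[_ [k xk]] := bop_funP x.
exists `|k| => // h; have := xk h; have [->|h0] := eqVneq h 0.
  by rewrite !normr0 !mulr0.
move=> kh; have : 0 <= k * `|h| by exact: le_trans kh.
by rewrite pmulr_lge0 ?normr_gt0// => k0; rewrite (ger0_norm k0).
Qed.

Lemma bop_make H K (f : H -> K) (c : CC R) : linear f ->
  (forall h, `|f h| <= c * `|h|) -> exists x : 'B(H, K), forall h, x h = f h.
Proof.
move=> lf fc; suff fP : f \in @bounded_op R H K by exists (Bop fP).
by apply/asboolP; split=> //; exists c.
Qed.

Lemma bop_ext H K (x y : 'B(H, K)) : (forall h, x h = y h) -> x = y.
Proof. by move=> xy; apply/val_inj/funext. Qed.

Lemma bopZDE H K a (x y : 'B(H, K)) h : (a *: x + y) h = a *: x h + y h.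
Proof. by []. Qed.

Lemma bopZ H K (x : 'B(H, K)) a h : x (a *: h) = a *: x h.
Proof. exact: (linearZ_LR x). Qed.

Lemma bopB H K (x : 'B(H, K)) h k : x (h - k) = x h - x k.
Proof. exact: (linearB x). Qed.

Lemma bop0 H K (x : 'B(H, K)) : x 0 = 0.
Proof. exact: (linear0 x). Qed.

Lemma bopBE H K (x y : 'B(H, K)) h : (x - y) h = x h - y h.
Proof. by []. Qed.

Lemma bop_compE H K L (x : 'B(K, L)) (y : 'B(H, K)) h : (x \ob y) h = x (y h).
Proof. by []. Qed.

Lemma bop_compA H K L P (x : 'B(L, P)) (y : 'B(K, L)) (z : 'B(H, K)) :
  x \ob (y \ob z) = x \ob y \ob z.
Proof. exact: bop_ext. Qed.

Lemma bop_comp1 H K (x : 'B(H, K)) : x \ob bop_id H = x.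
Proof. exact: bop_ext. Qed.

Lemma bop_1comp H K (x : 'B(H, K)) : bop_id K \ob x = x.
Proof. exact: bop_ext. Qed.

Lemma bop_compPl H K L a (x y : 'B(K, L)) (z : 'B(H, K)) :
  (a *: x + y) \ob z = a *: (x \ob z) + y \ob z.
Proof. exact: bop_ext. Qed.

Lemma bop_compPr H K L a (x y : 'B(H, K)) (z : 'B(K, L)) :
  z \ob (a *: x + y) = a *: (z \ob x) + z \ob y.
Proof. by apply: bop_ext => h; rewrite bop_compE !bopZDE linearP. Qed.

Lemma bop_comp0 H K L (z : 'B(K, L)) : z \ob (0 : 'B(H, K)) = 0.
Proof. by apply: bop_ext => h; rewrite bop_compE linear0. Qed.

Lemma bop_0comp H K L (z : 'B(H, K)) : (0 : 'B(K, L)) \ob z = 0.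
Proof. exact: bop_ext. Qed.

Lemma adj_exists H K (x : 'B(H, K)) :
  exists y : 'B(K, H), forall h k, inner (x h) k = inner h (y k).
Proof.
have [c c0 xc] := bop_bound x.
have /choice[y xy] k : exists z, forall h, inner (x h) k = inner h z.
  have [|a s t|s|z _ zP] := @riesz_representation R H H idfun
      (fun h => inner (x h) k) (c * `|k|) (ex_intro _ 0 I).
  - by rewrite mulr_ge0.
  - by exists (a *: s + t); split=> //; rewrite linearP linearPl.
  - by rewrite (le_trans (inner_normM _ _))// mulrAC ler_wpM2r.
  - by exists z.
have [|k|z zE] := @bop_make K H y c.
- move=> a s t; apply: inner_extr => h.
  by rewrite -xy !linearPr /= -!xy.
- have [->|y0] := eqVneq (y k) 0; first by rewrite normr0 mulr_ge0.
  rewrite -(@ler_pM2l _ `|y k|) ?normr_gt0// -expr2 -inner_norm -xy.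
  rewrite mulrCA mulrA -(ger0_norm (_ : 0 <= inner (x (y k)) k)).
    by rewrite (le_trans (inner_normM _ _))// ler_wpM2r.
  by rewrite xy.
by exists z => h k; rewrite zE.
Qed.

Lemma adjP H K (x : 'B(H, K)) h k : inner (x h) k = inner h (adj x k).
Proof.
have [y xy] := adj_exists x.
have /(_ (ex_intro _ y xy)) := @xgetPex _ (0 : 'B(K, H))
  [set y : 'B(K, H) | forall h k, inner (x h) k = inner h (y k)].
exact.
Qed.

Lemma adj_unique H K (x : 'B(H, K)) (y : 'B(K, H)) :
  (forall h k, inner (x h) k = inner h (y k)) -> adj x = y.
Proof.
by move=> xy; apply: bop_ext => k; apply: inner_extr => h; rewrite -adjP xy.
Qed.

Lemma adjPr H K (x : 'B(H, K)) k h : inner k (x h) = inner (adj x k) h.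
Proof. by rewrite form_conj (adjP x) -form_conj. Qed.

Lemma adjK H K (x : 'B(H, K)) : adj (adj x) = x.
Proof. by apply: adj_unique => k h; rewrite -adjPr. Qed.

Lemma adj_inj H K : injective (@adj R H K).
Proof. exact: can_inj (@adjK H K). Qed.

Lemma adj_linear H K a (x y : 'B(H, K)) :
  adj (a *: x + y) = a^* *: adj x + adj y.
Proof.
apply: adj_unique => h k.
by rewrite !bopZDE linearPl linearPr /= conjCK !adjP.
Qed.

Lemma adj0 H K : adj (0 : 'B(H, K)) = 0.
Proof. by apply: adj_unique => h k; rewrite linear0l linear0r. Qed.

Lemma adj_comp H K L (x : 'B(K, L)) (y : 'B(H, K)) :
  adj (x \ob y) = adj y \ob adj x.
Proof. by apply: adj_unique => h k; rewrite !bop_compE !adjP. Qed.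

Lemma adj_id H : adj (bop_id H) = bop_id H.
Proof. exact: adj_unique. Qed.

(** A set and its orthogonal complement together span a dense subspace. *)
Lemma bop_ext_perp H K (S : Type) (T : S -> H) (x y : 'B(H, K)) :
  (forall s, x (T s) = y (T s)) ->
  (forall h, (forall s, inner (T s) h = 0) -> x h = y h) -> x = y.
Proof.
move=> xyT xyN; apply: bop_ext => h; apply/eqP; rewrite -subr_eq0.
apply/eqP/inner_ext => k; rewrite linear0l -bopBE adjP.
set z := adj _ k.
suff z0 : z = 0 by rewrite z0 linear0r.
have zT s : inner (T s) z = 0 by rewrite /z -adjP bopBE xyT subrr linear0l.
apply: inner_eq0.
by rewrite {2}/z -adjP bopBE (xyN z zT) subrr linear0l.
Qed.

(** The functional T s |-> <U s, l> is represented by a vector z(l) in the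
    closure of the range of T, and the extension is the adjoint of z.  Its
    vanishing on the complement of the range of T is the position of z(l). *)
Lemma bop_extension (E H : hilbertType R) (S : Type) (T : S -> E) (U : S -> H)
    (c : CC R) : (exists s : S, True) -> 0 <= c ->
  (forall a s t, exists u, T u = a *: T s + T t /\ U u = a *: U s + U t) ->
  (forall s, `|U s| <= c * `|T s|) ->
  exists Z : 'B(E, H), (forall s, Z (T s) = U s) /\
    forall e, (forall s, inner (T s) e = 0) -> Z e = 0.
Proof.
move=> S0 c0 linTU UT.
have /choice[z zP] l :
    exists z, closure (range T) z /\ forall s, inner (U s) l = inner (T s) z.
  have [|a s t|s|z zT zP] := @riesz_representation R E S T
      (fun s => inner (U s) l) (c * `|l|) S0.
  - by rewrite mulr_ge0.
  - have [u [Tu Uu]] := linTU a s t.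
    by exists u; split=> //; rewrite Uu linearPl.
  - by rewrite (le_trans (inner_normM _ _))// mulrAC ler_wpM2r.
  - by exists z.
have z_perp l e : (forall s, inner (T s) e = 0) -> inner (z l) e = 0.
  by move=> Te; apply: closure_inner_eq0 (zP l).1 _ => _ [s _ <-].
have [|l|W WE] := @bop_make H E z c.
- move=> a l m; apply/eqP; rewrite -subr_eq0; apply/eqP/inner_eq0.
  set d := _ - _.
  have dT s : inner (T s) d = 0.
    rewrite /d linearBr linearPr /= -!(zP _).2 linearPr /=; exact: subrr.
  by rewrite {1}/d linearBl linearPl /= !z_perp// mulr0 addr0 subr0.
- have [->|z0] := eqVneq (z l) 0; first by rewrite normr0 mulr_ge0.
  rewrite -(@ler_pM2r _ `|z l|) ?normr_gt0// -expr2 -inner_norm.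
  rewrite -(ger0_norm (innerxx_ge0 _)).
  apply: closure_inner_le (zP l).1 _; first by rewrite mulr_ge0.
  move=> _ [s _ <-]; rewrite -(zP l).2 (le_trans (inner_normM _ _))//.
  by rewrite mulrAC ler_wpM2r.
exists (adj W); split=> [s|e Te]; apply: inner_ext => l.
  by rewrite adjP adjK WE (zP l).2.
by rewrite adjP adjK WE linear0l form_conj z_perp// rmorph0.
Qed.

End Operators.

(** * Orthogonal projections *)

Section Projections.
Context (R : realType).
Implicit Types H K L : hilbertType R.

Definition linear_subspace H (D : set H) :=
  D 0 /\ forall (a : CC R) x y, D x -> D y -> D (a *: x + y).

Lemma bop_closure_eq H K (x y : 'B(H, K)) (A : set H) h :
  (forall a, A a -> x a = y a) -> closure A h -> x h = y h.
Proof.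
move=> xy Ah; apply/eqP; rewrite -subr_eq0 -bopBE; apply/eqP/inner_ext => k.
rewrite adjP linear0l; apply: closure_inner_eq0 Ah _ => a /xy xya.
by rewrite -adjP bopBE xya subrr linear0l.
Qed.

(** The identity of D extends to an operator P that kills the complement of D.
    The Riesz vector of s |-> <s, h> shows that P h lies in the closure of D. *)
Lemma orth_proj_exists H (D : set H) : linear_subspace D ->
  exists P : 'B(H, H), [/\ forall h, closure D (P h),
    forall d, D d -> P d = d &
    forall h, (forall d, D d -> inner d h = 0) -> P h = 0].
Proof.
move=> [D0 Dlin]; pose T := fun s : D => val s.
have ex0 : exists _ : D, True by exists (SigSub (mem_set D0)).
have Tlin a (s t : D) : exists u : D, T u = a *: T s + T t.
  by exists (SigSub (mem_set (Dlin a _ _ (set_valP s) (set_valP t)))).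
have rangeT : range T `<=` D by move=> _ [s _ <-]; exact: set_valP.
have DT d : D d -> exists s : D, T s = d.
  by move=> Dd; exists (SigSub (mem_set Dd)).
have [a s t|s|P [PT Pperp]] := @bop_extension R H H D T T 1 ex0 ler01.
- by have [u Tu] := Tlin a s t; exists u.
- by rewrite mul1r.
have PD d : D d -> P d = d by move=> /DT[s <-].
have Dperp h : (forall d, D d -> inner d h = 0) -> P h = 0.
  by move=> Dh; apply: Pperp => s; apply: Dh; exact: set_valP.
exists P; split=> // h.
have [|a s t|s|z zT zP] := @riesz_representation R H D T
    (fun s => inner (T s) h) `|h| ex0.
- exact: normr_ge0.
- by have [u Tu] := Tlin a s t; exists u; rewrite Tu linearPl.
- by rewrite (le_trans (inner_normM _ _))// mulrC.
have zD : closure D z by exact: closureS zT.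
suff -> : P h = z by [].
have Pz : P z = z by exact: (@bop_closure_eq H H P (bop_id H) D).
apply/eqP; rewrite -subr_eq0 -[X in _ - X]Pz -linearB; apply/eqP/Dperp.
by move=> _ /DT[s <-]; rewrite linearBr /= zP subrr.
Qed.

(** Stability of D under x and x* makes x preserve both D and its complement. *)
Lemma proj_commute H (D : set H) (P x : 'B(H, H)) :
  (forall d, D d -> P d = d) ->
  (forall h, (forall d, D d -> inner d h = 0) -> P h = 0) ->
  (forall d, D d -> D (x d)) -> (forall d, D d -> D (adj x d)) ->
  P \ob x = x \ob P.
Proof.
move=> PD Pperp xD axD.
apply: (@bop_ext_perp R H H D (fun s => val s)) => [s|h Dh].
  have Ds : D (val s) by exact: set_valP.
  by rewrite !bop_compE PD ?(PD _ Ds)//; exact: xD.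
have {}Dh d : D d -> inner d h = 0.
  by move=> Dd; exact: Dh (SigSub (mem_set Dd)).
rewrite !bop_compE (Pperp h Dh) linear0 Pperp// => d Dd.
by rewrite adjPr; apply/Dh/axD.
Qed.

End Projections.

(** * Limits and series of complex numbers *)

(* Keeps conversion from unfolding complex numbers into pairs of reals when it
   compares norms and limits. *)
Opaque CC.

Section ComplexSeries.
Context (R : realType).

(** For a partial order the positive cone is closed because it is given by the
    equation z = |z|. *)
Lemma cvg_complex_ge0 (T : Type) (F : set_system T) (f : T -> CC R) (l : CC R) :
  ProperFilter F -> f @ F --> l -> (\forall t \near F, 0 <= f t) -> 0 <= l.
Proof.
move=> FF fl f0; suff -> : l = `|l| by [].
apply/eqP; rewrite -subr_eq0; apply/eqP; apply: (@small_eq0 _ _ 2) => e e0.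
have Fl : \forall t \near F, `|l - f t| < e by move/cvgrPdist_lt : fl; exact.
have [t [ft lt]] := filter_ex (filterI f0 Fl).
have -> : l - `|l| = (l - f t) + (`|f t| - `|l|).
  by rewrite (ger0_norm ft) addrA subrK.
rewrite mulr_natr mulr2n (le_trans (ler_normD _ _))// lerD ?ltW//.
by rewrite (le_lt_trans (ler_dist_dist _ _))// distrC.
Qed.

Lemma cvg_complex_le (T : Type) (F : set_system T) (f g : T -> CC R)
    (l m : CC R) : ProperFilter F -> f @ F --> l -> g @ F --> m ->
  (\forall t \near F, f t <= g t) -> l <= m.
Proof.
move=> FF fl gm fg; rewrite -subr_ge0.
apply: (@cvg_complex_ge0 _ F (g \- f)).
  exact: (@cvgB (CC R) (CC R) T F _ g f m l gm fl).
by apply: filterS fg => t; rewrite /= subr_ge0.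
Qed.

Lemma cvg_of_real (u : nat -> R) l :
  u @ \oo --> l -> (of_real \o u : nat -> CC R) @ \oo --> of_real l.
Proof.
move=> ul; apply/cvgrPdist_lt => e e0.
have eE : of_real (re_part e) = e by rewrite re_partK// gtr0_real.
have e0' : 0 < re_part e by rewrite -ltr_of_real eE.
move/cvgrPdist_lt : ul => /(_ _ e0'); apply: filterS => n.
rewrite -ltr_of_real eE /= => h; apply: le_lt_trans h.
rewrite -[X in `|X|](_ : of_real (l - u n) = _); last exact: rmorphB.
by rewrite normc_def /= expr0n/= addr0 sqrtr_sqr.
Qed.

Lemma ge0_series_le (u : nat -> CC R) (m n : nat) :
  (forall k, 0 <= u k) -> (m <= n)%N -> series u m <= series u n.
Proof.
move=> u0 mn; rewrite -subr_ge0 sub_series_geq//.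
by rewrite sumr_ge0.
Qed.

Lemma ge0_series_le_lim (u : nat -> CC R) n :
  (forall k, 0 <= u k) -> cvgn (series u) -> series u n <= limn (series u).
Proof.
move=> u0 u_cvg.
have cst_cvg : (fun=> series u n) @ \oo --> series u n.
  exact: (@cvg_cst (CC R)).
have le_near : \forall m \near \oo, series u n <= series u m.
  by exists n => // m /= nm; exact: ge0_series_le.
exact: (@cvg_complex_le _ \oo _ _ _ _ _ cst_cvg u_cvg le_near).
Qed.

Lemma series_lim_le (u : nat -> CC R) (B : CC R) :
  cvgn (series u) -> (forall n, series u n <= B) -> limn (series u) <= B.
Proof.
move=> u_cvg uB.
have cst_cvg : (fun=> B) @ \oo --> B by exact: (@cvg_cst (CC R)).
have le_near : \forall m \near \oo, series u m <= B by exact: nearW.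
exact: (@cvg_complex_le _ \oo _ _ _ _ _ u_cvg cst_cvg le_near).
Qed.

Lemma ge0_series_cvg (u : nat -> CC R) (B : CC R) :
  (forall k, 0 <= u k) -> (forall n, series u n <= B) -> cvgn (series u).
Proof.
move=> u0 uB; pose r n := re_part (series u n).
have rE n : of_real (r n) = series u n.
  by rewrite re_partK// ger0_real// sumr_ge0.
have B_real : B \is Num.real by rewrite -(ler_real (uB 0)) ger0_real// sumr_ge0.
have r_incr : nondecreasing_seq r.
  by move=> m n mn; rewrite -ler_of_real !rE ge0_series_le.
have r_ub : has_ubound (range r).
  exists (re_part B) => _ [n _ <-].
  by rewrite -ler_of_real rE re_partK.
have := cvg_of_real (nondecreasing_cvgn r_incr r_ub).
rewrite (_ : of_real \o r = series u); first by move=> /cvgP.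
by apply/funext => n; rewrite /= rE.
Qed.

End ComplexSeries.

Section SeriesLinear.
Context (C : numClosedFieldType).

Lemma series_cvg_lin (a : C) (u v : nat -> C) (l m : C) :
  series u @ \oo --> l -> series v @ \oo --> m ->
  series (fun n => a * u n + v n) @ \oo --> a * l + m.
Proof.
move=> ul vm.
have -> : series (fun n => a * u n + v n) = (fun n => a * series u n + series v n).
  by apply/funext => n; rewrite /series/= big_split /= -mulr_sumr.
apply: cvgD vm; apply: cvgM ul; exact: cvg_cst.
Qed.

Lemma series_cvg_conj (u : nat -> C) (l : C) :
  series u @ \oo --> l -> series (fun n => (u n)^*) @ \oo --> l^*.
Proof.
move=> ul; apply/cvgrPdist_lt => e e0.
move/cvgrPdist_lt : ul => /(_ e e0).
by apply: filterS => n; rewrite /series/= -rmorph_sum -rmorphB norm_conjC.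
Qed.

Lemma limE (u : nat -> C) l : u @ \oo --> l -> limn u = l.
Proof. exact: cvg_lim. Qed.

End SeriesLinear.

(** Finitely many coordinates pass to the limit; a bound uniform in n on the
    left then holds for the limit sequence. *)
Lemma series_sqdist_cvg (K : numFieldType) (V : normedModType K) (T : Type)
    (F : set_system T) (FF : Filter F) (x a : nat -> V) (y : T -> nat -> V) n :
  (forall i, (fun t => y t i) @ F --> a i) ->
  (fun t => series (fun i => `|x i - y t i| ^+ 2) n) @ F -->
    series (fun i => `|x i - a i| ^+ 2) n.
Proof.
move=> ya; elim: n => [|n IHn].
  rewrite {2}/series/= big_geq//.
  rewrite (_ : (fun t => _) = fun=> 0); first exact: cvg_cst.
  by apply/funext => t; rewrite /series/= big_geq.
have step (z : nat -> V) : series (fun i => `|x i - z i| ^+ 2) n.+1 =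
    series (fun i => `|x i - z i| ^+ 2) n + `|x n - z n| * `|x n - z n|.
  by rewrite /series/= big_nat_recr//= expr2.
rewrite (_ : (fun t => _) = fun t => series (fun i => `|x i - y t i| ^+ 2) n +
  `|x n - y t n| * `|x n - y t n|); last by apply/funext => t; exact: step.
have dist_cvg : (fun t => `|x n - y t n|) @ F --> `|x n - a n|.
  by apply: cvg_norm; apply: cvgB; [exact: cvg_cst|exact: ya].
by rewrite step; apply: cvgD IHn _; exact: cvgM.
Qed.

Arguments series_cvg_lin {C} a {u v l m}.

(** * The Hilbert space of square summable sequences *)

Section SquareSummable.
Context (R : realType) (H : hilbertType R).
Implicit Types x y : nat -> H.

Definition sqnorm_seq x : nat -> CC R := fun n => `|x n| ^+ 2.

Lemma sqnorm_seq_ge0 x n : 0 <= sqnorm_seq x n.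
Proof. exact: exprn_ge0. Qed.

Lemma square_summableP x :
  square_summable x <-> exists B, forall n, series (sqnorm_seq x) n <= B.
Proof.
split=> [x_cvg|[B xB]]; last exact: ge0_series_cvg (sqnorm_seq_ge0 x) xB.
exists (limn (series (sqnorm_seq x))) => n.
exact: ge0_series_le_lim (sqnorm_seq_ge0 x) x_cvg.
Qed.

Lemma sqnormD_le (u v : H) :
  `|u + v| ^+ 2 <= `|u| ^+ 2 *+ 2 + `|v| ^+ 2 *+ 2.
Proof.
rewrite -subr_ge0.
have -> : `|u| ^+ 2 *+ 2 + `|v| ^+ 2 *+ 2 - `|u + v| ^+ 2 = `|u - v| ^+ 2.
  by rewrite parallelogram.
exact: exprn_ge0.
Qed.

Definition l2_pred : {pred nat -> H} := fun x => `[< square_summable x >].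

Lemma l2_submod : submod_closed l2_pred.
Proof.
split=> [|a x y /asboolP/square_summableP[B xB] /asboolP/square_summableP[C yC]];
  apply/asboolP/square_summableP.
  exists 0 => n; rewrite /series/= big1// => i _.
  by rewrite /sqnorm_seq normr0 expr0n.
exists (`|a| ^+ 2 *+ 2 * B + C *+ 2) => n.
apply: (@le_trans _ _ (`|a| ^+ 2 *+ 2 * series (sqnorm_seq x) n +
    series (sqnorm_seq y) n *+ 2)); last first.
  by rewrite lerD// ?lerMn2r ?yC// ler_wpM2l ?xB// mulrn_wge0// exprn_ge0.
rewrite /series/= mulr_sumr -sumrMnl -big_split /=.
apply: ler_sum => i _; rewrite /sqnorm_seq.
by rewrite (le_trans (sqnormD_le _ _))// normrZ exprMn mulrnAl.
Qed.

HB.instance Definition _ :=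
  GRing.isSubmodClosed.Build (CC R) (nat -> H) l2_pred l2_submod.

Record l2 := L2 { l2_fun :> nat -> H ; l2_funP : l2_fun \in l2_pred }.

HB.instance Definition _ := [isSub for l2_fun].
HB.instance Definition _ := [Choice of l2 by <:].
HB.instance Definition _ := [SubChoice_isSubLmodule of l2 by <:].

Lemma l2_summable (x : l2) : square_summable x.
Proof. exact/asboolP/(l2_funP x). Qed.

Arguments l2_summable : clear implicits.

Lemma l2_ext (x y : l2) : (forall n, x n = y n) -> x = y.
Proof. by move=> xy; apply/val_inj/funext. Qed.

Lemma l2PE (a : CC R) (x y : l2) n : (a *: x + y) n = a *: x n + y n.
Proof. by []. Qed.

Lemma l2BE (x y : l2) n : (x - y) n = x n - y n.
Proof. by []. Qed.

(** Reduces the convergence of a series of inner products to series of squared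
    norms; the nesting and the final 0 match iterated use of
    [series_cvg_lin]. *)
Lemma polarization (u v : H) :
  inner u v = 4^-1 * `|u + v| ^+ 2 + (- 4^-1 * `|u - v| ^+ 2 +
    ('i / 4 * `|u + 'i *: v| ^+ 2 + (- 'i / 4 * `|u - 'i *: v| ^+ 2 + 0))).
Proof.
rewrite -!inner_norm !(linearBl, linearDl, linearBr, linearDr) /= !dotZl !dotZr.
rewrite conjCi.
set a := inner u u; set b := inner v u; set c := inner u v; set d := inner v v.
transitivity (2^-1 * (b + c) + 2^-1 * ('i * 'i) * (b - c)); last by field.
by rewrite -expr2 sqrCi; field.
Qed.

Lemma series_inner_cvg (x y : l2) :
  cvgn (series (fun n => inner (x n) (y n) : CC R)).
Proof.
have sq (z : l2) : cvgn (series (sqnorm_seq z)) by exact: l2_summable.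
have z0 : series (fun=> 0 : CC R) @ \oo --> (0 : CC R).
  rewrite (_ : series _ = fun=> 0); first exact: (@cvg_cst (CC R)).
  by apply/funext => n; rewrite /series/= big1.
rewrite (_ : (fun n => _) = (fun n => 4^-1 * sqnorm_seq (x + y) n +
  (- 4^-1 * sqnorm_seq (x - y) n + ('i / 4 * sqnorm_seq (x + 'i *: y) n +
  (- 'i / 4 * sqnorm_seq (x - 'i *: y) n + 0))))).
  apply: cvgP; exact: (series_cvg_lin _ (sq _) (series_cvg_lin _ (sq _)
    (series_cvg_lin _ (sq _) (series_cvg_lin _ (sq _) z0)))).
by apply/funext => n; rewrite polarization.
Qed.

Arguments series_inner_cvg : clear implicits.

Definition l2_inner (x y : l2) : CC R :=
  limn (series (fun n => inner (x n) (y n) : CC R)).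

Lemma l2_innerPl (a : CC R) (x y z : l2) :
  l2_inner (a *: x + y) z = a * l2_inner x z + l2_inner y z.
Proof.
apply: limE; rewrite (_ : (fun n => _) =
  fun n => a * inner (x n) (z n) + inner (y n) (z n)).
  exact: series_cvg_lin (series_inner_cvg x z) (series_inner_cvg y z).
by apply/funext => n; rewrite l2PE linearPl.
Qed.

Lemma l2_inner_conj (x y : l2) : l2_inner y x = (l2_inner x y)^*.
Proof.
apply: limE; rewrite (_ : (fun n => _) = fun n => (inner (x n) (y n))^*).
  exact: series_cvg_conj (series_inner_cvg x y).
by apply/funext => n; rewrite form_conj.
Qed.

Lemma l2_innerPr (a : CC R) (x y z : l2) :
  l2_inner z (a *: x + y) = a^* * l2_inner z x + l2_inner z y.
Proof.
rewrite l2_inner_conj l2_innerPl rmorphD rmorphM /=.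
by rewrite -(l2_inner_conj x z) -(l2_inner_conj y z).
Qed.

Lemma l2_sqnorm_le (x : l2) n : series (sqnorm_seq x) n <= l2_inner x x.
Proof.
rewrite /l2_inner (_ : (fun n => _) = sqnorm_seq x).
  exact: ge0_series_le_lim (sqnorm_seq_ge0 x) (l2_summable x).
by apply/funext => k; rewrite inner_norm.
Qed.

Lemma l2_sqnorm_lim_le (x : l2) (B : CC R) :
  (forall n, series (sqnorm_seq x) n <= B) -> l2_inner x x <= B.
Proof.
rewrite /l2_inner (_ : (fun n => _) = sqnorm_seq x).
  exact: series_lim_le (l2_summable x).
by apply/funext => k; rewrite inner_norm.
Qed.

Lemma l2_coord_sqnorm_le (x : l2) n : `|x n| ^+ 2 <= l2_inner x x.
Proof.
apply: le_trans (l2_sqnorm_le x n.+1).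
by rewrite /series/= big_nat_recr//= lerDr sumr_ge0// => i _; exact: exprn_ge0.
Qed.

Lemma l2_inner_gt0 (x : l2) : x != 0 -> 0 < l2_inner x x.
Proof.
move=> x0; rewrite lt_def (le_trans (exprn_ge0 _ _) (l2_coord_sqnorm_le x 0))//.
rewrite andbT; apply: contra x0 => /eqP x0; apply/eqP/l2_ext => n.
apply/eqP; rewrite -normr_eq0 -sqrf_eq0 eq_le exprn_ge0// andbT -x0.
exact: l2_coord_sqnorm_le.
Qed.

Lemma l2_bilinear : bilinear_for (GRing.Scale.Law.clone _ _ *%R _)
  (GRing.Scale.Law.clone _ _ (@Num.conj (CC R) \; *%R) _) l2_inner.
Proof.
by split=> [z a x y|z a x y]; [exact: l2_innerPl|exact: l2_innerPr].
Qed.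

HB.instance Definition _ := bilinear_isBilinear.Build (CC R) l2 l2 (CC R)
  _ _ l2_inner l2_bilinear.

Lemma l2_hermitian (x y : l2) :
  l2_inner x y = (-1) ^+ false * @Num.conj (CC R) (l2_inner y x).
Proof. by rewrite expr0 mul1r l2_inner_conj. Qed.

HB.instance Definition _ := @isHermitianSesquilinear.Build (CC R) l2 false
  (@Num.conj (CC R)) l2_inner l2_hermitian.
HB.instance Definition _ := isDotProduct.Build (CC R) l2 l2_inner l2_inner_gt0.

Definition l2_norm (x : l2) : CC R := sqrtC (l2_inner x x).

Lemma l2_inner_ge0 (x : l2) : 0 <= l2_inner x x.
Proof. exact: le_trans (exprn_ge0 2 (normr_ge0 _)) (l2_coord_sqnorm_le x 0). Qed.

Lemma l2_norm_ge0 (x : l2) : 0 <= l2_norm x.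
Proof. by rewrite sqrtC_ge0 l2_inner_ge0. Qed.

Lemma l2_normK (x : l2) : l2_norm x ^+ 2 = l2_inner x x.
Proof. exact: sqrtCK. Qed.

Lemma l2_normD (x y : l2) : l2_norm (x + y) <= l2_norm x + l2_norm y.
Proof.
rewrite -(@ler_pXn2r _ 2)// ?nnegrE ?addr_ge0 ?l2_norm_ge0// sqrrD !l2_normK.
have -> : l2_inner (x + y) (x + y) =
    l2_inner x x + (l2_inner x y + (l2_inner x y)^*) + l2_inner y y.
  by rewrite linearDl !linearDr /= -(l2_inner_conj x y) !addrA.
rewrite lerD2r lerD2l.
have -> : l2_inner x y + (l2_inner x y)^* = 'Re (l2_inner x y) *+ 2.
  by rewrite mulr2n ReE -splitr.
rewrite lerMn2r/= (le_trans (leif_Re_Creal _).1)//.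
rewrite -(@ler_pXn2r _ 2)// ?nnegrE ?mulr_ge0 ?l2_norm_ge0// exprMn !l2_normK.
exact: form_cauchy_schwarz.
Qed.

Lemma l2_normZ (a : CC R) (x : l2) : l2_norm (a *: x) = `|a| * l2_norm x.
Proof.
apply/eqP; rewrite -(@eqrXn2 _ 2)// ?mulr_ge0 ?l2_norm_ge0// exprMn !l2_normK.
by rewrite dotZl dotZr mulrA normCK.
Qed.

Lemma l2_norm_eq0 (x : l2) : l2_norm x = 0 -> x = 0.
Proof.
move=> x0; apply/eqP/negPn/negP => /l2_inner_gt0.
by rewrite -l2_normK x0 expr0n ltxx.
Qed.

HB.instance Definition _ := Lmodule_isNormed.Build (CC R) l2
  l2_normD l2_normZ l2_norm_eq0.

Lemma l2_normrE (x : l2) : `|x| = l2_norm x.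
Proof. by []. Qed.

Lemma l2_coord_le (x : l2) n : `|x n| <= `|x|.
Proof.
rewrite -(@ler_pXn2r _ 2)// ?nnegrE// l2_normrE l2_normK.
exact: l2_coord_sqnorm_le.
Qed.

(** Coordinatewise limits exist in H.  Bounds on partial sums of |x - y|^2 pass
    to the limit in y, which gives both the square summability of the limit and
    the convergence in norm. *)
Lemma l2_complete (F : set_system l2) : ProperFilter F -> cauchy F -> cvg F.
Proof.
move=> FF Fc.
have Fball (e : CC R) : 0 < e -> exists x : l2, \forall y \near F, `|x - y| < e.
  move/cauchyP : Fc => /(_ _)/= Fc e0.
  have [x Fx] := Fc e e0; exists x.
  by move: Fx; rewrite -ball_normE.
have limit_ex n : exists l : H, (fun x : l2 => x n) @ F --> l.
  pose Fn : set_system H := (fun x : l2 => x n) @ F.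
  have FFn : ProperFilter Fn by exact: fmap_proper_filter.
  exists (lim Fn); apply: (cauchy_cvg Fn); apply: cauchy_exP => e /Fball[x Fx].
  exists (x n); apply: filterS Fx => y xy; rewrite -ball_normE /ball_/=.
  by rewrite -l2BE (le_lt_trans (l2_coord_le _ _)).
have [a Fa] := choice limit_ex.
have tail (x : l2) (e : CC R) n : 0 < e -> (\forall y \near F, `|x - y| < e) ->
    series (fun i => `|x i - a i| ^+ 2) n <= e ^+ 2.
  move=> e0 Fx.
  have cvg_l : (fun y : l2 => series (fun i => `|x i - y i| ^+ 2) n) @ F -->
      series (fun i => `|x i - a i| ^+ 2) n.
    exact: series_sqdist_cvg.
  have cvg_r : (fun y : l2 => e ^+ 2) @ F --> e ^+ 2.
    exact: (@cvg_cst (CC R)).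
  apply: (@cvg_complex_le _ _ F _ _ _ _ _ cvg_l cvg_r).
  apply: filterS Fx => y xy.
  apply: (@le_trans _ _ (`|x - y| ^+ 2)).
    rewrite l2_normrE l2_normK; exact: (l2_sqnorm_le (x - y)).
  by rewrite ler_pXn2r ?nnegrE// ltW.
have a_l2 : a \in l2_pred.
  have [x Fx] := Fball 1 ltr01.
  have xa : (l2_fun x - a) \in l2_pred.
    by apply/asboolP/square_summableP; exists (1 ^+ 2) => n; exact: tail.
  have -> : a = l2_fun x - (l2_fun x - a) by rewrite subKr.
  exact: (rpredB (l2_funP x) xa).
apply/cvg_ex; exists (L2 a_l2 : l2).
apply/cvgrPdist_lt => e e0; have e2 : 0 < e / 2 by rewrite divr_gt0.
have [x Fx] := Fball _ e2.
have xa : `|x - (L2 a_l2 : l2)| <= e / 2.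
  rewrite -(@ler_pXn2r _ 2)// ?nnegrE//; last exact: ltW.
  rewrite l2_normrE l2_normK; apply: l2_sqnorm_lim_le => n.
  exact: (tail x (e / 2) n).
apply: filterS Fx => y xy.
have -> : (L2 a_l2 : l2) - y = (x - y) - (x - (L2 a_l2 : l2)).
  by rewrite opprB [RHS]addrC addrA subrK.
rewrite (le_lt_trans (ler_normB _ _))// [ltRHS]splitr.
exact: ltr_leD.
Qed.

HB.instance Definition _ := Uniform_isComplete.Build l2 l2_complete.

Lemma l2_inner_norm (x : l2) : (l2_inner : {dot l2 for @Num.conj (CC R)}) x x = `|x| ^+ 2.
Proof. by rewrite l2_normrE l2_normK. Qed.

HB.instance Definition _ := isHilbert.Build R l2 l2_inner_norm.

End SquareSummable.

Arguments l2_summable {R H} x.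
Arguments series_inner_cvg {R H} x y.

(** * Amplifications *)

Section Amplification.
Context (R : realType).
Implicit Types H K L : hilbertType R.

Lemma l2_sqnorm_cvg H (x : l2 H) :
  series (fun n => `|x n| ^+ 2) @ \oo --> (`|x| ^+ 2 : CC R).
Proof.
rewrite l2_normrE l2_normK /l2_inner.
rewrite (_ : (fun n => inner _ _) = sqnorm_seq x); first exact: l2_summable.
by apply/funext => n; rewrite inner_norm.
Qed.

Lemma l2_sqnorm_ge H (x : l2 H) n : series (fun n => `|x n| ^+ 2) n <= `|x| ^+ 2.
Proof. by rewrite l2_normrE l2_normK; exact: l2_sqnorm_le. Qed.

Lemma l2_sqnorm_le_bound H (x : l2 H) (B : CC R) :
  (forall n, series (fun n => `|x n| ^+ 2) n <= B) -> `|x| ^+ 2 <= B.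
Proof. by move=> xB; rewrite l2_normrE l2_normK; exact: l2_sqnorm_lim_le. Qed.

Lemma l2_make H (x : nat -> H) (B : CC R) :
  (forall n, series (fun n => `|x n| ^+ 2) n <= B) ->
  exists xi : l2 H, forall n, xi n = x n.
Proof.
move=> xB; have xP : x \in @l2_pred R H.
  by apply/asboolP/square_summableP; exists B.
by exists (L2 xP).
Qed.

Lemma amp_l2 H K (x : 'B(H, K)) (xi : l2 H) :
  (fun n => x (xi n)) \in @l2_pred R K.
Proof.
have [c c0 xc] := bop_bound x.
apply/asboolP/square_summableP; exists (c ^+ 2 * `|xi| ^+ 2) => n.
apply: (@le_trans _ _ (c ^+ 2 * series (fun n => `|xi n| ^+ 2) n)).
  rewrite /series/= mulr_sumr; apply: ler_sum => i _.
  by rewrite /sqnorm_seq -exprMn ler_pXn2r ?nnegrE// mulr_ge0.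
by rewrite ler_wpM2l ?exprn_ge0// l2_sqnorm_ge.
Qed.

Definition amp_fun H K (x : 'B(H, K)) (xi : l2 H) : l2 K := L2 (amp_l2 x xi).

Lemma amp_fun_le H K (x : 'B(H, K)) (c : CC R) : 0 <= c ->
  (forall h, `|x h| <= c * `|h|) -> forall xi, `|amp_fun x xi| <= c * `|xi|.
Proof.
move=> c0 xc xi; rewrite -(@ler_pXn2r _ 2)// ?nnegrE ?mulr_ge0//.
apply: l2_sqnorm_le_bound => n; rewrite exprMn.
apply: (@le_trans _ _ (c ^+ 2 * series (fun n => `|xi n| ^+ 2) n)).
  rewrite /series/= mulr_sumr; apply: ler_sum => i _.
  by rewrite -exprMn ler_pXn2r ?nnegrE// mulr_ge0.
by rewrite ler_wpM2l ?exprn_ge0// l2_sqnorm_ge.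
Qed.

Lemma amp_fun_bounded H K (x : 'B(H, K)) :
  amp_fun x \in @bounded_op R (l2 H) (l2 K).
Proof.
apply/asboolP; split; last first.
  by have [c c0 xc] := bop_bound x; exists c; exact: amp_fun_le.
by move=> a xi eta; apply: l2_ext => n; exact: (linearP x).
Qed.

(** The operator 1 (x) x from l2 (x) H to l2 (x) K. *)
Definition amp H K (x : 'B(H, K)) : 'B(l2 H, l2 K) := Bop (amp_fun_bounded x).

Lemma ampE H K (x : 'B(H, K)) xi n : amp x xi n = x (xi n).
Proof. by []. Qed.

Lemma amp_le H K (x : 'B(H, K)) (c : CC R) : 0 <= c ->
  (forall h, `|x h| <= c * `|h|) -> forall xi, `|amp x xi| <= c * `|xi|.
Proof. exact: amp_fun_le. Qed.

Lemma ampP H K (a : CC R) (x y : 'B(H, K)) :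
  amp (a *: x + y) = a *: amp x + amp y.
Proof. by apply: bop_ext => xi; apply: l2_ext. Qed.

Lemma ampB H K (x y : 'B(H, K)) xi : amp (x - y) xi = amp x xi - amp y xi.
Proof. exact: l2_ext. Qed.

Lemma amp0 H K : amp (0 : 'B(H, K)) = 0.
Proof. by apply: bop_ext => xi; apply: l2_ext. Qed.

Lemma amp_comp H K L (x : 'B(K, L)) (y : 'B(H, K)) :
  amp (x \ob y) = amp x \ob amp y.
Proof. by apply: bop_ext => xi; apply: l2_ext. Qed.

Lemma amp_id H : amp (bop_id H) = bop_id (l2 H).
Proof. by apply: bop_ext => xi; apply: l2_ext. Qed.

Lemma l2_innerE H (xi eta : l2 H) :
  inner xi eta = limn (series (fun n => inner (xi n) (eta n) : CC R)).
Proof. by []. Qed.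

Lemma adj_amp H K (x : 'B(H, K)) : adj (amp x) = amp (adj x).
Proof.
apply: adj_unique => xi eta; rewrite !l2_innerE.
by congr (limn (series _)); apply/funext => n; rewrite !ampE adjP.
Qed.

Lemma coord_op_bounded H n : (fun xi : l2 H => xi n) \in @bounded_op R (l2 H) H.
Proof.
apply/asboolP; split; first by move=> a xi eta; rewrite l2PE.
by exists 1 => xi; rewrite mul1r l2_coord_le.
Qed.

Definition coord_op H n : 'B(l2 H, H) := Bop (coord_op_bounded H n).

Lemma coord_opE H n (xi : l2 H) : coord_op H n xi = xi n.
Proof. by []. Qed.

Lemma pairing_index_in H K (xi : l2 H) (eta : l2 K) :
  (@square_summable R H `*` @square_summable R K) (l2_fun xi, l2_fun eta).
Proof. by split; exact: l2_summable. Qed.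

Definition pairing_index H K (xi : l2 H) (eta : l2 K) : predual_index H K :=
  SigSub (mem_set (pairing_index_in xi eta)).

(** This turns weak* questions on B(H,K) into norm questions on l2 H and
    l2 K. *)
Lemma predual_pairingE H K (x : 'B(H, K)) (xi : l2 H) (eta : l2 K) :
  predual_pairing x (pairing_index xi eta) = inner (amp x xi) eta.
Proof. by []. Qed.

Lemma predual_indexP H K (p : predual_index H K) :
  exists xi eta, p = pairing_index xi eta.
Proof.
case: p => -[xi eta] pP; have [/= xiP etaP] := set_mem pP.
have xi2 : xi \in @l2_pred R H by apply/asboolP.
have eta2 : eta \in @l2_pred R K by apply/asboolP.
by exists (L2 xi2), (L2 eta2); exact: val_inj.
Qed.

End Amplification.

Arguments amp {R H K} x : simpl never.
Arguments coord_op {R H} n : simpl never.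
Arguments inner : simpl never.

(** * Domination by a single sequence *)

Section Concatenation.
Context (R : realType).
Implicit Types H K L : hilbertType R.

Lemma ler_sum_subset (I : eqType) (s t : seq I) (F : I -> CC R) :
  uniq s -> uniq t -> {subset s <= t} -> (forall i, 0 <= F i) ->
  \sum_(i <- s) F i <= \sum_(i <- t) F i.
Proof.
move=> us ut st F0; rewrite [leRHS](bigID (mem s))/=.
have -> : \sum_(i <- t | i \in s) F i = \sum_(i <- s) F i.
  rewrite -big_filter; apply/perm_big/uniq_perm => //.
    exact: filter_uniq.
  by move=> i; rewrite mem_filter; case: (boolP (i \in s)) => // /st.
by rewrite lerDl sumr_ge0.
Qed.

Lemma cvg_sum_seq (C : numFieldType) (T : Type) (F : set_system T)
    (FF : Filter F) (f : nat -> T -> C) (l : nat -> C) n :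
  (forall i, f i @ F --> l i) ->
  (fun t => \sum_(0 <= i < n) f i t) @ F --> \sum_(0 <= i < n) l i.
Proof.
move=> fl; elim: n => [|n IHn].
  rewrite big_geq// (_ : (fun t => _) = fun=> 0); first exact: cvg_cst.
  by apply/funext => t; rewrite big_geq.
rewrite big_nat_recr//= (_ : (fun t => _) =
  fun t => \sum_(0 <= i < n) f i t + f n t); first exact: cvgD.
by apply/funext => t; rewrite big_nat_recr.
Qed.

Definition concat_seq K (z : nat -> l2 K) (m : nat) : K :=
  if (pickle_inv m : option (nat * nat)) is Some (i, j) then z i j else 0.

Lemma concat_seq_pickle K (z : nat -> l2 K) i j :
  concat_seq z (pickle (i, j)) = z i j.
Proof. by rewrite /concat_seq pickleK_inv. Qed.

(** A pairing of indices identifies l2 (l2 K) with l2 K.  Since zeta depends on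
    the sequence z only, one seminorm |(1 (x) x) zeta| dominates the square sum
    of the seminorms |(1 (x) x) z_i|. *)
Lemma l2_concat K (z : nat -> l2 K) (B : CC R) :
  (forall n, series (fun i => `|z i| ^+ 2) n <= B) ->
  exists zeta : l2 K, forall L (x : 'B(K, L)) n,
    series (fun i => `|amp x (z i)| ^+ 2) n <= `|amp x zeta| ^+ 2.
Proof.
move=> zB.
have [|zeta zetaE] := @l2_make R K (concat_seq z) B.
  move=> n; pose s := pmap (pickle_inv : nat -> option (nat * nat)) (iota 0 n).
  have sE : series (fun m => `|concat_seq z m| ^+ 2) n =
      \sum_(p <- s) `|z p.1 p.2| ^+ 2.
    rewrite big_pmap /series/= /index_iota subn0; apply: eq_bigr => m _.
    rewrite /concat_seq; case: pickle_inv => [[i j]|]//=.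
    by rewrite normr0 expr0n.
  have [N NP] : exists N, forall p, p \in s -> (maxn p.1 p.2 < N)%N.
    exists (\max_(p <- s) maxn p.1 p.2).+1 => p ps.
    exact: (@leq_bigmax_seq _ s xpredT (fun p : nat * nat => maxn p.1 p.2) p).
  pose t := [seq (i, j) | i <- iota 0 N, j <- iota 0 N].
  have st : {subset s <= t}.
    move=> [i j] /NP/=; rewrite gtn_max => /andP[iN jN].
    by apply/allpairsP; exists (i, j); split; rewrite // mem_iota.
  rewrite sE (le_trans (ler_sum_subset _ _ st _))//.
  - by apply: pmap_uniq (iota_uniq _ _); exact: pickle_invK.
  - by rewrite allpairs_uniq ?iota_uniq// => -[? ?] [? ?].
  rewrite big_allpairs (le_trans _ (zB N))// /series/= /index_iota subn0.
  apply: ler_sum => i _; apply: le_trans (l2_sqnorm_ge _ N).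
  by rewrite /series/= /index_iota subn0.
exists zeta => L x n.
have cvg_l : (fun N => \sum_(0 <= i < n) series (fun j => `|amp x (z i) j| ^+ 2) N)
    @ \oo --> (\sum_(0 <= i < n) `|amp x (z i)| ^+ 2 : CC R).
  by apply: cvg_sum_seq => i; exact: l2_sqnorm_cvg.
have cvg_r : (fun N : nat => `|amp x zeta| ^+ 2 : CC R) @ \oo --> `|amp x zeta| ^+ 2.
  exact: (@cvg_cst (CC R)).
apply: (@cvg_complex_le _ _ \oo _ _ _ _ _ cvg_l cvg_r); apply: nearW => N.
pose t := [seq (i, j) | i <- iota 0 n, j <- iota 0 N].
have [M MP] : exists M, forall p, p \in t -> (pickle p < M)%N.
  exists (\max_(p <- t) pickle p).+1 => p pt.
  exact: (@leq_bigmax_seq _ t xpredT (fun p => pickle p) p).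
apply: le_trans (l2_sqnorm_ge _ M).
have -> : \sum_(0 <= i < n) series (fun j => `|amp x (z i) j| ^+ 2) N =
    \sum_(m <- [seq pickle p | p <- t]) `|amp x zeta m| ^+ 2.
  rewrite big_map big_allpairs /series/= /index_iota !subn0.
  apply: eq_bigr => i _; apply: eq_bigr => j _.
  by rewrite zetaE concat_seq_pickle.
apply: ler_sum_subset => [||m|m]; rewrite ?iota_uniq//.
- rewrite map_inj_uniq; last exact: pcan_inj pickleK.
  by rewrite allpairs_uniq ?iota_uniq// => -[? ?] [? ?].
- by move=> /mapP[p pt ->]; rewrite mem_index_iota /= MP.
Qed.

(** The ultrastrong seminorms x |-> |(1 (x) x) zeta| are directed. *)
Lemma l2_concat_seq K (s : seq (l2 K)) :
  exists zeta : l2 K, forall L (x : 'B(K, L)),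
    \sum_(z <- s) `|amp x z| ^+ 2 <= `|amp x zeta| ^+ 2.
Proof.
have [n|zeta zetaP] := @l2_concat K (fun i => s`_i) (\sum_(z <- s) `|z| ^+ 2).
  rewrite /series/=; have [ns|sn] := leqP n (size s).
    rewrite [leRHS](big_nth 0) (big_cat_nat (leq0n n) ns)//= lerDl.
    by rewrite sumr_ge0// => i _; exact: exprn_ge0.
  rewrite (big_cat_nat (leq0n _) (ltnW sn))//= -(big_nth 0 xpredT (fun z => `|z| ^+ 2)).
  rewrite [X in _ + X]big_nat_cond [X in _ + X]big1 ?addr0// => i /andP[/andP[si _] _].
  by rewrite nth_default// normr0 expr0n.
exists zeta => L x; rewrite [leLHS](big_nth 0); exact: zetaP.
Qed.

End Concatenation.

(** * The weak* topology *)

Section WeakStarTopology.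
Context (R : realType).
Implicit Types H K L : hilbertType R.

Lemma initial_cvg (S : choiceType) (T : topologicalType) (f : S -> T)
    (F : set_system S) (s : S) : Filter F ->
  f @ F --> f s -> F --> (s : initial_topology f).
Proof.
move=> FF fF A [_ [[B Bo <-] /= Bfs] BA].
by apply: filterS BA _; apply: fF; exact: open_nbhs_nbhs.
Qed.

Lemma eval_continuous (I : Type) (T : topologicalType) (i : I) :
  continuous (fun f : {ptws I -> T} => f i).
Proof.
move=> f; have /cvg_sup/(_ i) fi : f --> f by exact: cvg_id.
exact: cvg_comp fi (@initial_continuous _ _ _ f).
Qed.

Lemma pairing_continuous H K (p : predual_index H K) :
  continuous (fun x : 'B(H, K) => predual_pairing x p).
Proof.
move=> x.
have c1 := @initial_continuous _ _
  (@predual_pairing R H K : 'B(H, K) -> {ptws predual_index H K -> CC R}) x.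
exact: cvg_comp c1 (@eval_continuous _ _ p _).
Qed.

Lemma cvg_bop H K (F : set_system 'B(H, K)) (x : 'B(H, K)) : Filter F ->
  (forall p, (fun y => predual_pairing y p) @ F --> predual_pairing x p) ->
  F --> x.
Proof.
move=> FF Fp; apply: (@initial_cvg _ _
  (@predual_pairing R H K : 'B(H, K) -> {ptws predual_index H K -> CC R})).
apply/cvg_sup => p; apply: initial_cvg; exact: Fp.
Qed.

End WeakStarTopology.

(** * Weak* continuity through domination *)

Section WeakStarDuality.
Context (R : realType).
Implicit Types H K L : hilbertType R.

Lemma le_concat2 H (z1 z2 : l2 H) : exists z : l2 H, forall K (x : 'B(H, K)),
  `|amp x z1| <= `|amp x z| /\ `|amp x z2| <= `|amp x z|.
Proof.
have [z zP] := l2_concat_seq [:: z1; z2]; exists z => K x.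
have := zP K x; rewrite !big_cons big_nil addr0 => h.
split; rewrite -(@ler_pXn2r _ 2)// ?nnegrE//; apply: le_trans h.
  by rewrite lerDl exprn_ge0.
by rewrite lerDr exprn_ge0.
Qed.

(** The seminorms |(1 (x) (c - x)) zeta| are directed, and by Cauchy-Schwarz the
    filter of their neighbourhoods of x is finer than the weak* one. *)
Lemma closure_ultrastrong H K (C : set 'B(H, K)) (x : 'B(H, K)) :
  (forall (zeta : l2 H) (e : CC R), 0 < e ->
    exists2 c, C c & `|amp (c - x) zeta| < e) -> closure C x.
Proof.
move=> Cx.
pose F := filter_from [set q : l2 H * CC R | 0 < q.2]
  (fun q => [set c | C c /\ `|amp (c - x) q.1| < q.2]).
have FF : ProperFilter F.
  apply: filter_from_proper; last first.
    by move=> [zeta e] /= /(Cx zeta)[c]; exists c.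
  apply: filter_from_filter; first by exists (0, 1) => /=.
  move=> [z1 e1] [z2 e2] /= e10 e20; have [z zP] := le_concat2 z1 z2.
  have [e12|/ltW e21] := real_leP (gtr0_real e10) (gtr0_real e20).
    exists (z, e1) => // c [/= Cc ce]; have [h1 h2] := zP _ (c - x).
    split; split=> //; first exact: le_lt_trans ce.
    by apply: le_lt_trans (lt_le_trans ce e12).
  exists (z, e2) => // c [/= Cc ce]; have [h1 h2] := zP _ (c - x).
  split; split=> //; last exact: le_lt_trans ce.
  by apply: le_lt_trans (lt_le_trans ce e21).
have Fx : F --> x.
  apply: cvg_bop => p; have [xi [eta ->]] := predual_indexP p.
  apply/(@cvgrPdist_lt (CC R) (CC R)) => e e0.
  have d0 : 0 < `|eta| + 1 by rewrite ltr_wpDl.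
  exists (xi, e / (`|eta| + 1)) => /=; first by rewrite divr_gt0.
  move=> c [Cc ce]; rewrite !predual_pairingE distrC -linearBl /= -ampB.
  rewrite (le_lt_trans (inner_normM _ _))//.
  rewrite (@le_lt_trans _ _ (`|amp (c - x) xi| * (`|eta| + 1)))//.
    by rewrite ler_wpM2l// lerDl.
  by rewrite -ltr_pdivlMr.
move=> B /Fx FB; have FC : F C by exists (0, 1) => //= c [].
have [c [Cc Bc]] := filter_ex (filterI FC FB).
by exists c.
Qed.

Lemma vN_ex H (M : vonNeumannAlgebra H) (x : 'B(H, H)) :
  vN_set M x ->
  exists m : M, val m = x.
Proof. by move=> Mx; exists (SigSub (mem_set Mx)). Qed.

Lemma vN_in H (M : vonNeumannAlgebra H) (m : M) : vN_set M (val m).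
Proof. exact: set_valP. Qed.

Lemma vN0 H (M : vonNeumannAlgebra H) : vN_set M 0.
Proof.
have := vN_linP (-1) (vN_idP M) (vN_idP M).
by rewrite scaleN1r addNr.
Qed.

Lemma vNZ H (M : vonNeumannAlgebra H) (a : CC R) x :
  vN_set M x -> vN_set M (a *: x).
Proof. by move=> /(vN_linP a)/(_ (vN0 M)); rewrite addr0. Qed.

(** Continuity at 0 and homogeneity bound f by finitely many pairings
    <(1 (x) y) xi, eta>.  At y* y such a pairing is <(1 (x) y) xi, (1 (x) y) eta>,
    of modulus at most |(1 (x) y) xi|^2 + |(1 (x) y) eta|^2, and all the vectors
    involved are dominated by a single zeta. *)
Lemma weakstar_dominated K (N : vonNeumannAlgebra K) (f : N -> CC R) :
  continuous f ->
  (forall (a : CC R) (y z : N), val z = a *: val y -> f z = a * f y) ->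
  exists zeta : l2 K, forall y z : N, val z = adj (val y) \ob val y ->
    `|f z| <= `|amp (val y) zeta| ^+ 2.
Proof.
move=> f_cont f_hom; have [zer zerE] := vN_ex (vN0 N).
have f_zer : f zer = 0 by rewrite (f_hom 0 zer zer) ?mul0r// zerE scaler0.
pose seminorm (l : seq (l2 K * l2 K)) (y : 'B(K, K)) : CC R :=
  \sum_(p <- l) `|inner (amp y p.1) p.2|.
have seminorm_ge0 l y : 0 <= seminorm l y by rewrite sumr_ge0.
pose F := filter_from [set: seq (l2 K * l2 K)]
  (fun l => [set y : N | seminorm l (val y) <= 1]).
have FF : Filter F.
  apply: filter_from_filter; first by exists [::].
  move=> l1 l2' _ _; exists (l1 ++ l2') => // y /=.
  rewrite /seminorm big_cat /= -!/(seminorm _ _) => h; split.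
    by apply: le_trans h; rewrite lerDl.
  by apply: le_trans h; rewrite lerDr.
have F_zer : F --> zer.
  apply: (initial_cvg (f := set_val)); apply: cvg_bop => p.
  have [xi [eta ->]] := predual_indexP p.
  apply/(@cvgrPdist_lt (CC R) (CC R)) => e e0.
  (* The factor 2 / e turns the bound 1 on the seminorm into e / 2 < e. *)
  exists [:: ((2 / e) *: xi, eta)] => // y yl.
  have {yl} : `|inner (amp (val y) ((2 / e) *: xi)) eta| <= 1.
    by move: yl; rewrite /mkset /seminorm big_seq1.
  rewrite bopZ dotZl normrM gtr0_norm ?divr_gt0// => h.
  have zer0 : inner (amp (set_val zer) xi) eta = 0.
    by rewrite [set_val zer]zerE amp0 -[LHS]/(inner 0 eta) linear0l.
  suff : `|inner (amp (set_val zer) xi) eta - inner (amp (val y) xi) eta| < e.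
    by [].
  rewrite zer0 sub0r normrN.
  rewrite (@le_lt_trans _ _ (e / 2))// ?gtr_pMr// ?invf_lt1 ?ltr1n//.
  rewrite -(@ler_pM2l _ (2 / e)) ?divr_gt0// (le_trans h)//.
  by rewrite mulrA divfK ?gt_eqF// divff.
have [l _ lP] : F [set y | `|f y| <= 1].
  have /(@cvgrPdist_lt (CC R) (CC R))/(_ 1 ltr01) := f_cont zer.
  move=> /F_zer; apply: filterS => y; rewrite /= f_zer sub0r normrN; exact: ltW.
have f_le y : `|f y| <= seminorm l (val y).
  apply: (@small_le _ _ _ 1); [exact: normr_real|exact: ger0_real|].
  move=> e e0; rewrite mulr1; set s := seminorm l (val y).
  have s0 : 0 < s + e by rewrite ltr_wpDl// seminorm_ge0.
  have [z zE] := vN_ex (vNZ (s + e)^-1 (vN_in y)).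
  have /lP : seminorm l (val z) <= 1.
    rewrite zE /seminorm.
    have -> : \sum_(p <- l) `|inner (amp ((s + e)^-1 *: val y) p.1) p.2| =
        (s + e)^-1 * s.
      rewrite mulr_sumr; apply: eq_bigr => p _.
      have -> : amp ((s + e)^-1 *: val y) = (s + e)^-1 *: amp (val y).
        by rewrite -[_ *: val y]addr0 ampP amp0 addr0.
      by rewrite dotZl normrM gtr0_norm ?invr_gt0.
    by rewrite mulrC ler_pdivrMr// mul1r lerDl ltW.
  rewrite /= (f_hom _ _ _ zE) normrM gtr0_norm ?invr_gt0//.
  by rewrite mulrC ler_pdivrMr// mul1r.
have [zeta zetaP] := l2_concat_seq ([seq p.1 | p <- l] ++ [seq p.2 | p <- l]).
exists zeta => y z zE; apply: le_trans (f_le z) (le_trans _ (zetaP _ _)).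
rewrite big_cat /= !big_map -big_split zE; apply: ler_sum => p _.
rewrite amp_comp bop_compE -adj_amp -adjPr.
set a := amp _ _; set b := amp _ _.
apply: le_trans (inner_normM _ _) _.
rewrite -(@ler_pM2l _ 2)// -subr_ge0.
have -> : 2 * (`|a| ^+ 2 + `|b| ^+ 2) - 2 * (`|a| * `|b|) =
    (`|a| - `|b|) ^+ 2 + (`|a| ^+ 2 + `|b| ^+ 2) by ring.
apply: addr_ge0; last by rewrite addr_ge0// exprn_ge0.
by rewrite real_exprn_even_ge0// rpredB// normr_real.
Qed.

(** By Riesz f is a vector functional of (1 (x) y) zeta, hence a pairing. *)
Lemma weakstar_continuous K (N : vonNeumannAlgebra K) (f : N -> CC R)
    (zeta : l2 K) (c : CC R) : 0 <= c ->
  (forall (a : CC R) (x y z : N), val z = a *: val x + val y ->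
    f z = a * f x + f y) ->
  (forall y, `|f y| <= c * `|amp (val y) zeta|) -> continuous f.
Proof.
move=> c0 f_lin f_bnd.
have [zer zerE] := vN_ex (vN0 N).
have [//|a x y|//|eta _ fE] :=
  @riesz_representation R (l2 K) N (fun y => amp (val y) zeta) f c (ex_intro _ zer I).
  have [z zE] := vN_ex (vN_linP a (vN_in x) (vN_in y)).
  by exists z; rewrite (f_lin _ _ _ _ zE) zE ampP.
have -> : f = fun y => predual_pairing (val y) (pairing_index zeta eta).
  exact/funext.
move=> y; have c1 := @initial_continuous _ _ (set_val : N -> 'B(K, K)) y.
exact: cvg_comp c1 (@pairing_continuous _ _ _ _ _).
Qed.

(** Each pairing of theta(y) with xi and eta is at most |eta| |(1 (x) y) zeta|,
    so it is weak* continuous in y. *)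
Lemma normal_continuous H K (M : vonNeumannAlgebra H) (N : vonNeumannAlgebra K)
    (theta : N -> M) :
  (forall (a : CC R) (x y z : N), val z = a *: val x + val y ->
    val (theta z) = a *: val (theta x) + val (theta y)) ->
  (forall xi : l2 H, exists zeta : l2 K,
    forall y, `|amp (val (theta y)) xi| <= `|amp (val y) zeta|) ->
  continuous theta.
Proof.
move=> theta_lin theta_dom y.
have FF : Filter (theta @ nbhs y) by exact: fmap_filter.
apply: (@initial_cvg _ _ (set_val : M -> 'B(H, H))); apply: cvg_bop => p.
have [xi [eta ->]] := predual_indexP p; have [zeta zetaP] := theta_dom xi.
pose f z := predual_pairing (val (theta z)) (pairing_index xi eta).
suff : continuous f by apply.
apply: (@weakstar_continuous _ _ _ zeta `|eta|) => // [a x x' z zE|z].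
  rewrite /f !predual_pairingE (theta_lin _ _ _ _ zE).
  by rewrite ampP bopZDE linearPl.
rewrite /f predual_pairingE (le_trans (inner_normM _ _))// mulrC.
by rewrite ler_wpM2l.
Qed.

End WeakStarDuality.

(** * The double commutant theorem *)

Section DoubleCommutant.
Context (R : realType).
Implicit Types H K L : hilbertType R.

Lemma coord_op_amp H K (x : 'B(H, K)) n : coord_op n \ob amp x = x \ob coord_op n.
Proof. exact: bop_ext. Qed.

Lemma amp_adj_coord_op H K (x : 'B(H, K)) n :
  amp x \ob adj (coord_op n) = adj (coord_op n) \ob x.
Proof.
by apply: adj_inj; rewrite !adj_comp !adjK adj_amp coord_op_amp.
Qed.

Lemma coord_op_ext H K (x y : 'B(K, l2 H)) :
  (forall n, coord_op n \ob x = coord_op n \ob y) -> x = y.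
Proof.
move=> xy; apply: bop_ext => k; apply: l2_ext => n.
exact: (congr1 (fun z : 'B(K, H) => z k) (xy n)).
Qed.

Lemma matrix_ext H K (x y : 'B(l2 H, l2 K)) :
  (forall m n, coord_op m \ob (x \ob adj (coord_op n)) =
               coord_op m \ob (y \ob adj (coord_op n))) -> x = y.
Proof.
move=> xy; apply: adj_inj; apply: coord_op_ext => n.
by apply: adj_inj; rewrite !adj_comp !adjK; exact: coord_op_ext.
Qed.

Lemma l2_unit H (h : H) : exists xi : l2 H, xi 0%N = h.
Proof.
have [|xi xiE] := @l2_make R H (fun n => if n is 0%N then h else 0) (`|h| ^+ 2).
  case=> [|n]; first by rewrite /series/= big_geq// exprn_ge0.
  rewrite /series/= big_nat_recl//= big1 ?addr0// => i _.
  by rewrite normr0 expr0n.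
by exists xi; rewrite xiE.
Qed.

Lemma vector_functional_continuous H K (h : H) (k : K) :
  continuous (fun x : 'B(H, K) => inner (x h) k : CC R).
Proof.
have [xi xiE] := l2_unit h.
have -> : (fun x : 'B(H, K) => inner (x h) k : CC R) =
    fun x => predual_pairing x (pairing_index xi (adj (coord_op 0) k)).
  apply/funext => x; rewrite predual_pairingE -adjP coord_opE.
  by rewrite ampE xiE.
exact: pairing_continuous.
Qed.

Lemma closure_eq0 (T : topologicalType) (C : numFieldType) (f : T -> C)
    (A : set T) (x : T) :
  continuous f -> (forall a, A a -> f a = 0) -> closure A x -> f x = 0.
Proof.
move=> f_cont fA Ax; apply/eqP; apply: contraT; rewrite -normr_gt0 => fx.
have /cvgrPdist_lt/(_ _ fx)/Ax[a [/fA fa0]] := f_cont x.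
by rewrite /= fa0 subr0 ltxx.
Qed.

Lemma closure_intertwine H K (A : set 'B(H, K)) (a : 'B(K, K)) (b : 'B(H, H)) x :
  (forall y, A y -> a \ob y = y \ob b) -> closure A x -> a \ob x = x \ob b.
Proof.
move=> Aab Ax; apply: bop_ext => h; apply: inner_ext => k.
apply/eqP; rewrite -subr_eq0; apply/eqP; rewrite !bop_compE adjP.
pose f (y : 'B(H, K)) : CC R := inner (y h) (adj a k) - inner (y (b h)) k.
suff : f x = 0 by [].
apply: closure_eq0 Ax => [y|y /Aab yab]; last first.
  by rewrite /f -adjP -bop_compE yab subrr.
exact: (@cvgB (CC R) (CC R) _ _ _ _ _ _ _
  (@vector_functional_continuous H K h (adj a k) y)
  (@vector_functional_continuous H K (b h) k y)).
Qed.

Lemma commutant_subspace H (M : set 'B(H, H)) : subspace_set (commutant M).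
Proof.
split=> [b _|a x y xM yM b Mb]; first by rewrite bop_0comp bop_comp0.
by rewrite bop_compPl bop_compPr xM// yM.
Qed.

Lemma commutant_closed H (M : set 'B(H, H)) : closed (commutant M).
Proof.
move=> a Ma b Mb; apply/esym; apply: closure_intertwine Ma => c Mc.
exact/esym/Mc.
Qed.

Lemma commutant_adj H (M : vonNeumannAlgebra H) b :
  commutant M b -> commutant M (adj b).
Proof.
move=> bM a Ma; have := bM _ (vN_adjP Ma).
by move=> /(congr1 (@adj R H H)); rewrite !adj_comp adjK.
Qed.

(** The projection P onto the closure of (1 (x) M) zeta commutes with 1 (x) M, so
    the matrix entries of P lie in M' and P commutes with 1 (x) x.  Thus
    (1 (x) x) zeta remains in that closure, and x is an ultrastrong limit of
    elements of M. *)
Lemma double_commutant H (M : vonNeumannAlgebra H) x :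
  (forall b, commutant M b -> x \ob b = b \ob x) -> vN_set M x.
Proof.
move=> xM; apply: vN_closedP; apply: closure_ultrastrong => zeta e e0.
pose D := [set amp m zeta | m in vN_set M].
have D_lin : linear_subspace D.
  split; first by exists 0; rewrite ?amp0//; exact: vN0.
  move=> a _ _ [m Mm <-] [n Mn <-].
  by exists (a *: m + n); [exact: vN_linP|rewrite ampP].
have D_amp m d : vN_set M m -> D d -> D (amp m d).
  move=> Mm [n Mn <-]; exists (m \ob n); first exact: vN_mulP.
  by rewrite amp_comp.
have [P [P_D PD Pperp]] := orth_proj_exists D_lin.
have P_amp m : vN_set M m -> P \ob amp m = amp m \ob P.
  move=> Mm; apply: proj_commute PD Pperp _ _ => d Dd; first exact: D_amp.
  by rewrite adj_amp; apply: D_amp => //; exact: vN_adjP.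
have P_ampx : P \ob amp x = amp x \ob P.
  apply: matrix_ext => i j.
  have entry : commutant M (coord_op i \ob P \ob adj (coord_op j)).
    move=> m Mm; rewrite -bop_compA -amp_adj_coord_op bop_compA -(bop_compA _ P).
    by rewrite P_amp// !bop_compA coord_op_amp.
  rewrite -[in RHS]bop_compA !bop_compA coord_op_amp -!bop_compA amp_adj_coord_op.
  by have := xM _ entry; rewrite !bop_compA => <-.
have [_ [m Mm <-] mx] : exists2 d, D d & `|amp x zeta - d| < e.
  apply: (closure_normP D (amp x zeta)).1 => //.
  rewrite (_ : amp x zeta = P (amp x zeta)); first exact: P_D.
  have zetaP : P zeta = zeta.
    by apply: PD; exists (bop_id H); [exact: vN_idP|rewrite amp_id].
  by rewrite -[RHS]bop_compE P_ampx bop_compE zetaP.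
by exists m => //; rewrite ampB distrC.
Qed.

End DoubleCommutant.

(** * Spaces of operators stable under triple products *)

Section TernarySpaces.
Context (R : realType).
Implicit Types H K L : hilbertType R.

Definition products H K L (V : set 'B(K, L)) (W : set 'B(H, K)) :
  set 'B(H, L) := [set v \ob w | v in V & w in W].

Definition bop_span H K (A : set 'B(H, K)) : set 'B(H, K) :=
  smallest (@subspace_set R H K) A.

Lemma bop_span_sub H K (A : set 'B(H, K)) : A `<=` bop_span A.
Proof. exact: sub_gen_smallest. Qed.

Lemma bop_span_subspace H K (A : set 'B(H, K)) : subspace_set (bop_span A).
Proof.
split=> [C [[C0 _] _]//|a x y Ax Ay C CA].
by have [[_ Clin] _] := CA; apply: Clin; [exact: Ax CA|exact: Ay CA].
Qed.

Lemma bop_span_ind H K (A C : set 'B(H, K)) :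
  subspace_set C -> A `<=` C -> bop_span A `<=` C.
Proof. by move=> Cs AC x; apply. Qed.

Lemma qcomp_sub H K L (V : set 'B(K, L)) (W : set 'B(H, K)) (C : set 'B(H, L)) :
  subspace_set C -> closed C ->
  (forall v w, V v -> W w -> C (v \ob w)) -> qcomp V W `<=` C.
Proof.
move=> Cs Cc VWC x; rewrite /qcomp => x_cl; apply: Cc.
apply: closureS x_cl; apply: bop_span_ind => // _ [v Vv [w Ww <-]].
exact: VWC.
Qed.

Lemma qcomp_product H K L (V : set 'B(K, L)) (W : set 'B(H, K)) v w :
  V v -> W w -> qcomp V W (v \ob w).
Proof.
by move=> Vv Ww; apply: subset_closure; apply: bop_span_sub; exists v => //; exists w.
Qed.

Lemma qadj_in H K (V : set 'B(H, K)) v : V v -> qadj V (adj v).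
Proof. by move=> Vv; exists v. Qed.

Lemma qadjK H K (V : set 'B(H, K)) : qadj (qadj V) = V.
Proof.
apply/seteqP; split=> [_ [_ [v Vv <-] <-]|v Vv]; first by rewrite adjK.
by exists (adj v); [exists v|rewrite adjK].
Qed.

(** For the relation V of a homomorphism theta this is an algebra whose elements
    approximate theta(1). *)
Definition star_span H K (V : set 'B(H, K)) : set 'B(H, H) :=
  bop_span (products (qadj V) V).

Lemma star_span_product H K (V : set 'B(H, K)) v w :
  V v -> V w -> star_span V (adj v \ob w).
Proof.
by move=> Vv Vw; apply: bop_span_sub; exists (adj v); [exists v|exists w].
Qed.

Lemma star_span_ind H K (V : set 'B(H, K)) (C : set 'B(H, H)) :
  subspace_set C -> (forall v w, V v -> V w -> C (adj v \ob w)) ->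
  star_span V `<=` C.
Proof.
move=> Cs VC; apply: bop_span_ind => // _ [_ [v Vv <-] [w Vw <-]].
exact: VC.
Qed.

(** The form in which coinjectivity enters approximation arguments: V V* V is
    contained in N' V, hence in V.  It passes from V to V*. *)
Definition ternary H K (V : set 'B(H, K)) :=
  forall u v w, V u -> V v -> V w -> V (u \ob adj v \ob w).

Lemma ternary_qadj H K (V : set 'B(H, K)) : ternary V -> ternary (qadj V).
Proof.
move=> V3 _ _ _ [u Vu <-] [v Vv <-] [w Vw <-].
exists (w \ob adj v \ob u); first exact: V3.
by rewrite !adj_comp bop_compA.
Qed.

Lemma star_span_mul H K (V : set 'B(H, K)) x y : ternary V ->
  star_span V x -> star_span V y -> star_span V (x \ob y).
Proof.
move=> V3 Vx Vy; move: x Vx.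
apply: (@star_span_ind _ _ _ [set x | star_span V (x \ob y)]) => [|u v Vu Vv /=].
  have [s0 slin] := bop_span_subspace (products (qadj V) V).
  by split=> [|a x z Vx Vz] /=; rewrite ?bop_0comp// bop_compPl; exact: slin.
move: y Vy.
apply: (@star_span_ind _ _ _ [set y | star_span V (adj u \ob v \ob y)]).
  have [s0 slin] := bop_span_subspace (products (qadj V) V).
  by split=> [|a x z Vx Vz] /=; rewrite ?bop_comp0// bop_compPr; exact: slin.
move=> w z Vw Vz /=; rewrite -bop_compA; apply: star_span_product => //.
by rewrite bop_compA; exact: V3.
Qed.

Lemma star_span_adj H K (V : set 'B(H, K)) x :
  star_span V x -> star_span V (adj x).
Proof.
apply: (@star_span_ind _ _ _ [set x | star_span V (adj x)]).
  have [s0 slin] := bop_span_subspace (products (qadj V) V).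
  by split=> [|a y z Vy Vz] /=; rewrite ?adj0// adj_linear; exact: slin.
by move=> u v Vu Vv /=; rewrite adj_comp adjK; exact: star_span_product.
Qed.

Lemma l2_inner_eq0 H (xi eta : l2 H) :
  (forall n, inner (xi n) (eta n) = 0) -> inner xi eta = 0.
Proof.
move=> h; rewrite l2_innerE; apply: limE.
rewrite (_ : series _ = fun=> 0); first exact: (@cvg_cst (CC R)).
by apply/funext => n; rewrite /series/= big1.
Qed.

(** A ternary space V acts nondegenerately away from its common kernel, so
    span (V* V) contains an approximate unit there.  The projection onto the
    closure of span (V* V) zeta commutes with V* V, hence the component omega
    of zeta orthogonal to it is annihilated by V* V and therefore by V.  As zeta
    is orthogonal to the common kernel, omega vanishes. *)
Lemma star_span_approx H K (V : set 'B(H, K)) (zeta : l2 H) (e : CC R) :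
  ternary V ->
  (forall n h, (forall v, V v -> v h = 0) -> inner (zeta n) h = 0) ->
  0 < e -> exists2 j, star_span V j & `|amp j zeta - zeta| < e.
Proof.
move=> V3 zeta_perp e0; pose D := [set amp j zeta | j in star_span V].
have [s0 slin] := bop_span_subspace (products (qadj V) V).
have D_lin : linear_subspace D.
  split; first by exists 0; rewrite ?amp0//; exact: s0.
  move=> a _ _ [x Vx <-] [y Vy <-].
  by exists (a *: x + y); [exact: slin|rewrite ampP].
have D_amp j d : star_span V j -> D d -> D (amp j d).
  move=> Vj [x Vx <-]; exists (j \ob x); first exact: star_span_mul.
  by rewrite amp_comp.
have [P [P_D PD Pperp]] := orth_proj_exists D_lin.
have P_amp j : star_span V j -> P \ob amp j = amp j \ob P.
  move=> Vj; apply: proj_commute PD Pperp _ _ => d Dd; first exact: D_amp.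
  by rewrite adj_amp; apply: D_amp => //; exact: star_span_adj.
pose omega := zeta - P zeta.
have omega_ker j : star_span V j -> amp j omega = 0.
  move=> Vj; rewrite /omega bopB -[amp j (P zeta)]bop_compE -P_amp//.
  by rewrite bop_compE PD ?subrr//; exists j.
have omega_perp v n : V v -> v (omega n) = 0.
  move=> Vv; suff : amp v omega = 0.
    by move=> /(congr1 (fun xi : l2 K => xi n)).
  apply: inner_eq0; rewrite adjP adj_amp -bop_compE -amp_comp.
  by rewrite omega_ker ?inner0r//; exact: star_span_product.
have D_omega d : D d -> inner d omega = 0.
  move=> [j Vj <-]; rewrite adjP adj_amp omega_ker ?inner0r//.
  exact: star_span_adj.
have omega0 : omega = 0.
  apply: inner_eq0; rewrite {1}/omega innerBl.
  rewrite (closure_inner_eq0 (P_D zeta) D_omega) subr0.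
  by apply: l2_inner_eq0 => n; apply: zeta_perp => v Vv; exact: omega_perp.
have := P_D zeta; rewrite -(subr0_eq omega0).
move=> /closure_normP/(_ e e0)[_ [j Vj <-] je].
by exists j => //; rewrite distrC.
Qed.

End TernarySpaces.

Section KerExtensionality.
Context (R : realType).
Implicit Types H K L : hilbertType R.

(** The common kernel of V is the orthogonal complement of V* K. *)
Lemma bop_ext_star H K L (V : set 'B(H, K)) (x y : 'B(H, L)) :
  (forall v, V v -> x \ob adj v = y \ob adj v) ->
  (forall h, (forall v, V v -> v h = 0) -> x h = y h) -> x = y.
Proof.
move=> xyV xyN.
apply: (@bop_ext_perp R H L (set_type V * K) (fun p => adj (val p.1) p.2)) =>
  [[v k]/=|h hV].
  exact: (congr1 (fun z : 'B(K, L) => z k) (xyV _ (set_valP v))).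
apply: xyN => v Vv; apply: inner_ext => k.
rewrite inner0l form_conj.
have := hV (SigSub (mem_set Vv), k); rewrite /= adjP adjK => ->.
by rewrite rmorph0.
Qed.

End KerExtensionality.

(** * The intertwiners of a normal homomorphism *)

Section NormalHom.
Context (R : realType) (H K : hilbertType R).
Context (M : vonNeumannAlgebra H) (N : vonNeumannAlgebra K).
Variable theta : N -> M.
Hypothesis theta_hom : normal_star_hom theta.

Let t (y : N) : 'B(H, H) := val (theta y).
Let p : 'B(H, H) := t (vN_id N).
Let V := intertwiners theta.

Lemma hom_lin a (x y z : N) : val z = a *: val x + val y ->
  t z = a *: t x + t y.
Proof.
have [lin _ _ _] := theta_hom => zE.
have -> : z = vN_lin a x y by exact: val_inj.
by rewrite /t lin.
Qed.

Lemma hom_mul (x y z : N) : val z = val x \ob val y -> t z = t x \ob t y.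
Proof.
have [_ mul _ _] := theta_hom => zE.
have -> : z = vN_mul x y by exact: val_inj.
by rewrite /t mul.
Qed.

Lemma hom_adj (x z : N) : val z = adj (val x) -> t z = adj (t x).
Proof.
have [_ _ ad _] := theta_hom => zE.
have -> : z = vN_adj x by exact: val_inj.
by rewrite /t ad.
Qed.

Lemma hom_1l y : p \ob t y = t y.
Proof. by rewrite /p -(hom_mul (z := y))// bop_1comp. Qed.

Lemma hom_1r y : t y \ob p = t y.
Proof. by rewrite /p -(hom_mul (z := y))// bop_comp1. Qed.

Lemma hom_1adj : adj p = p.
Proof. by rewrite /p -(hom_adj (z := vN_id N))//= adj_id. Qed.

Lemma hom0 (z : N) : val z = 0 -> t z = 0.
Proof.
move=> z0; have := @hom_lin (-1) z z z.
by rewrite !scaleN1r !addNr => /(_ z0).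
Qed.

Lemma intertwiner_1 v : V v -> v \ob p = v.
Proof. by move=> /(_ (vN_id N)) /= <-; rewrite bop_1comp. Qed.

Lemma intertwiner_adj v y : V v -> t y \ob adj v = adj v \ob val y.
Proof.
move=> Vv; have [z zE] := vN_ex (vN_adjP (vN_in y)).
apply: adj_inj; rewrite !adj_comp !adjK -zE (Vv z).
by congr (_ \ob _); rewrite -[LHS](@hom_adj y z).
Qed.

Lemma intertwiner_1adj v : V v -> p \ob adj v = adj v.
Proof. by move=> Vv; rewrite /p intertwiner_adj// bop_comp1. Qed.

Lemma intertwiners_coinjective : coinjective N V.
Proof.
apply: qcomp_sub; [exact: commutant_subspace|exact: commutant_closed|].
move=> v _ Vv [w Vw <-] b Nb; have [y <-] := vN_ex Nb.
by rewrite -bop_compA -intertwiner_adj// !bop_compA (Vv y).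
Qed.

Lemma intertwiners_ternary : ternary V.
Proof.
move=> u v w Vu Vv Vw y; rewrite !bop_compA (Vu y) -(bop_compA _ (adj v)).
by rewrite -!bop_compA -(Vw y) !bop_compA -(bop_compA u) intertwiner_adj// !bop_compA.
Qed.

Lemma intertwiners_relation : quantum_relation M N V.
Proof.
split=> [|v v_cl y|a v b aN Vv bM y].
- split=> [y|a x y Vx Vy z]; first by rewrite bop_comp0 bop_0comp.
  by rewrite bop_compPl bop_compPr (Vx z) (Vy z).
- by apply: closure_intertwine v_cl => w; exact.
- rewrite !bop_compA -(aN _ (vN_in y)) -(bop_compA a) (Vv y) -!bop_compA.
  by rewrite (bM _ (vN_in (theta y))).
Qed.

(** A normal homomorphism has enough intertwiners: the positive functional
    <theta(.)h, h> is weak* continuous, so |theta(y)h| <= |y zeta| for some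
    zeta in l2 K.  The contraction Z sending y zeta to theta(y) h intertwines
    1 (x) y with theta(y), so the coordinates of its adjoint lie in V.  If they
    kill h, then <theta(1) h, h> = <zeta, Z* h> = 0. *)
Lemma intertwiners_separate h : (forall v, V v -> v h = 0) -> p h = 0.
Proof.
move=> Vh; have [_ _ _ theta_cont] := theta_hom.
pose f (y : N) : CC R := inner (t y h) h.
have f_cont : continuous f.
  move=> y; have c1 := theta_cont y.
  have c2 := @initial_continuous _ _ (set_val : M -> 'B(H, H)) (theta y).
  have c3 := @vector_functional_continuous R H H h h (val (theta y)).
  have c12 : (fun z => val (theta z)) @ y --> (val (theta y) : 'B(H, H)).
    exact: cvg_comp c1 c2.
  exact: cvg_comp c12 c3.
have f_hom (a : CC R) y z : val z = a *: val y -> f z = a * f y.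
  move=> zE; have [zer zerE] := vN_ex (vN0 N).
  rewrite /f (@hom_lin a y zer z) ?zerE ?addr0//.
  by rewrite (hom0 zerE) bopZDE innerPl inner0l addr0.
have [zeta zetaP] := weakstar_dominated f_cont f_hom.
have bnd y : `|t y h| <= 1 * `|amp (val y) zeta|.
  rewrite mul1r -(@ler_pXn2r _ 2)// ?nnegrE//.
  have [w wE] := vN_ex (vN_adjP (vN_in y)).
  have [z zE] := vN_ex (vN_mulP (vN_in w) (vN_in y)).
  have := zetaP y z; rewrite zE wE => /(_ erefl).
  rewrite /f (hom_mul zE) (hom_adj wE) bop_compE -adjPr inner_norm.
  by rewrite ger0_norm ?exprn_ge0.
have [a x y|Z [ZT Zperp]] := @bop_extension R (l2 K) H N
    (fun y => amp (val y) zeta) (fun y => t y h) 1 (ex_intro _ (vN_id N) I) ler01 _ bnd.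
  have [z zE] := vN_ex (vN_linP a (vN_in x) (vN_in y)).
  by exists z; rewrite zE ampP (hom_lin zE).
have Z_amp y : Z \ob amp (val y) = t y \ob Z.
  apply: (@bop_ext_perp R _ _ N (fun y => amp (val y) zeta)) => [x|e eT].
    have [z zE] := vN_ex (vN_mulP (vN_in y) (vN_in x)).
    by rewrite !bop_compE ZT -[amp _ _]bop_compE -amp_comp -zE ZT (hom_mul zE).
  rewrite !bop_compE (Zperp e eT) bop0; apply: Zperp => x.
  have [w wE] := vN_ex (vN_adjP (vN_in y)).
  have [z zE] := vN_ex (vN_mulP (vN_in w) (vN_in x)).
  by rewrite adjPr adj_amp -wE -bop_compE -amp_comp -zE.
have VZ n : V (coord_op n \ob adj Z).
  move=> y; have [w wE] := vN_ex (vN_adjP (vN_in y)).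
  rewrite bop_compA -coord_op_amp -!bop_compA; congr (_ \ob _).
  have := congr1 (@adj R _ _) (Z_amp w).
  by rewrite !adj_comp adj_amp wE adjK (hom_adj wE) adjK.
have Zh : adj Z h = 0.
  by apply: l2_ext => n; rewrite -coord_opE -bop_compE Vh.
have ph : inner (p h) h = 0.
  have -> : p h = Z zeta by rewrite /p -ZT amp_id.
  by rewrite adjP Zh inner0r.
apply: inner_eq0; rewrite -[in RHS]ph adjP hom_1adj -bop_compE hom_1l.
by rewrite adjP hom_1adj.
Qed.

Lemma intertwiners_separate_all h y :
  (forall v, V v -> v h = 0) -> t y h = 0.
Proof.
by move=> /intertwiners_separate ph; rewrite -hom_1r bop_compE ph bop0.
Qed.

End NormalHom.

Section NormalHomInjectivity.
Context (R : realType) (H K : hilbertType R).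
Context (M : vonNeumannAlgebra H) (N : vonNeumannAlgebra K).

Lemma intertwiners_inj (theta theta' : N -> M) :
  normal_star_hom theta -> normal_star_hom theta' ->
  intertwiners theta = intertwiners theta' -> theta = theta'.
Proof.
move=> hom hom' V'V; apply/funext => y; apply: val_inj.
apply: (@bop_ext_star R H K H (intertwiners theta)) => [v Vv|h Vh].
  by rewrite !intertwiner_adj// -V'V.
rewrite (intertwiners_separate_all hom) ?(intertwiners_separate_all hom')//.
by rewrite -V'V.
Qed.

End NormalHomInjectivity.

(** * The homomorphism of a coinjective relation *)

Section LogConvex.
Context (R : realType).

Lemma geometric_bound (a b z : R) : `|z| < 1 ->
  (forall n, a <= b * z ^+ n) -> a <= 0.
Proof.
move=> z1 ab; have z_cvg := cvg_geometric b z1.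
rewrite -(cvg_lim (@Rhausdorff R) z_cvg).
by apply: limr_ge; [exact: cvgP z_cvg|exact: nearW].
Qed.

(** The ratios r_(n+1) / r_n are nondecreasing, so r_n >= r_0 (r_1 / r_0)^n; this
    is compatible with growth at most c^n only if r_1 / r_0 <= c. *)
Lemma log_convex_growth (r : nat -> CC R) (c C : CC R) :
  (forall n, 0 <= r n) -> 0 <= c -> 0 <= C ->
  (forall n, r n.+1 ^+ 2 <= r n * r n.+2) ->
  (forall n, r n <= C * c ^+ n) -> r 1%N <= c * r 0%N.
Proof.
move=> r0 c0 C0 rconv rC.
have cr_real : c * r 0%N \is Num.real by rewrite ger0_real// mulr_ge0.
have [//|cr1] := real_leP (ger0_real (r0 1%N)) cr_real.
have r1_gt0 : 0 < r 1%N by apply: le_lt_trans cr1; rewrite mulr_ge0.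
have r0_gt0 : 0 < r 0%N.
  rewrite lt_def r0 andbT; apply/negP => /eqP r00.
  have := rconv 0%N; rewrite r00 mul0r => h.
  by have := lt_le_trans (exprn_gt0 2 r1_gt0) h; rewrite ltxx.
have ratio n : 0 < r n /\ r 1%N * r n <= r n.+1 * r 0%N.
  elim: n => [|n [rn IHn]]; first by split; [exact: r0_gt0|exact: lexx].
  have rn1 : 0 < r n.+1.
    by rewrite -(pmulr_lgt0 _ r0_gt0) (lt_le_trans _ IHn)// mulr_gt0.
  split=> //; rewrite -(ler_pM2r rn).
  have -> : r 1%N * r n.+1 * r n = r n.+1 * (r 1%N * r n) by ring.
  have -> : r n.+2 * r 0%N * r n = r 0%N * (r n * r n.+2) by ring.
  apply: le_trans (ler_wpM2l (r0 n.+1) IHn) _.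
  have -> : r n.+1 * (r n.+1 * r 0%N) = r 0%N * r n.+1 ^+ 2 by ring.
  by rewrite ler_wpM2l.
have geo n : r 1%N ^+ n * r 0%N <= r n * r 0%N ^+ n.
  elim: n => [|n IHn]; first by rewrite !expr0 mul1r mulr1.
  have -> : r 1%N ^+ n.+1 * r 0%N = r 1%N * (r 1%N ^+ n * r 0%N).
    by rewrite exprS; ring.
  apply: le_trans (ler_wpM2l (r0 1%N) IHn) _.
  have -> : r 1%N * (r n * r 0%N ^+ n) = r 0%N ^+ n * (r 1%N * r n) by ring.
  have -> : r n.+1 * r 0%N ^+ n.+1 = r 0%N ^+ n * (r n.+1 * r 0%N).
    by rewrite exprS; ring.
  by rewrite ler_wpM2l ?exprn_ge0//; have [] := ratio n.
pose z := c * r 0%N / r 1%N.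
have z0 : 0 <= z by rewrite divr_ge0// mulr_ge0.
have z1 : z < 1 by rewrite ltr_pdivrMr// mul1r.
have bound n : r 0%N <= C * z ^+ n.
  rewrite /z expr_div_n mulrA ler_pdivlMr ?exprn_gt0// mulrC.
  apply: le_trans (geo n) _; rewrite exprMn mulrA.
  by rewrite ler_wpM2r ?exprn_ge0.
have : r 0%N <= 0.
  rewrite -(re_partK (ger0_real (r0 0%N))) -[0]/(of_real 0) ler_of_real.
  apply: (@geometric_bound _ (re_part C) (re_part z)).
    by rewrite ger0_norm -?(ltr_of_real, ler_of_real) re_partK// ger0_real.
  move=> n; rewrite -ler_of_real of_realM of_realX.
  by rewrite !re_partK ?ger0_real.
by move=> /(lt_le_trans r0_gt0); rewrite ltxx.
Qed.

End LogConvex.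

Section Construction.
Context (R : realType) (H K : hilbertType R).
Context (M : vonNeumannAlgebra H) (N : vonNeumannAlgebra K).
Variable W : set 'B(H, K).
Hypothesis WW : forall u v, W u -> W v -> commutant N (u \ob adj v).
Hypothesis WM : forall v b, W v -> commutant M b -> W (v \ob b).

(* S consists of formal sums of pairs (v, k), evaluated by T as sums of vectors
   v* k; act z replaces every k by z k. *)
Let S := seq (set_type W * K).
Let T (s : S) : H := \sum_(p <- s) adj (val p.1) p.2.
Let act (z : 'B(K, K)) (s : S) : S := [seq (p.1, z p.2) | p <- s].

(* As u v* lies in N', the operator act z is adjoint to act z* for the
   semidefinite form <T s, T t>. *)
Let T_adj z s t : vN_set N z ->
  inner (T (act z s)) (T t) = inner (T s) (T (act (adj z) t)).
Proof.
move=> Nz; rewrite /T /act !big_map.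
rewrite !linear_sumlz /=; apply: eq_bigr => -[u k] _.
rewrite !linear_sumr /=; apply: eq_bigr => -[v l] _ /=.
have uv := WW (set_valP v) (set_valP u).
have [Wu Wv] : W (val u) /\ W (val v) by split; exact: set_valP.
have vuz : sval v (adj (sval u) (z k)) = z (sval v (adj (sval u) k)).
  exact: (congr1 (fun x : 'B(K, K) => x k) (uv z Nz)).
by rewrite -(adjP (sval v)) -(adjP (sval v)) -(adjP z) vuz.
Qed.

Let act_comp y z s : act y (act z s) = act (y \ob z) s.
Proof. by rewrite /act -map_comp. Qed.

Let T_growth (a : 'B(K, K)) (c : CC R) s : 0 <= c ->
  (forall k, `|a k| <= c * `|k|) ->
  exists2 C, 0 <= C & forall n, `|T (iter n (act a) s)| <= C * c ^+ n.
Proof.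
move=> c0 ac; have iterE n : iter n (act a) s = [seq (p.1, iter n a p.2) | p <- s].
  elim: n => [|n IHn]; first by rewrite -[LHS]map_id; apply: eq_map => -[].
  by rewrite iterS IHn /act -map_comp.
have iter_le n k : `|iter n a k| <= c ^+ n * `|k|.
  elim: n => [|n IHn]; first by rewrite expr0 mul1r.
  by rewrite iterS (le_trans (ac _))// exprS -mulrA ler_wpM2l.
suff [C C0 TC] : exists2 C, 0 <= C & forall n,
    `|\sum_(p <- s) adj (val p.1) (iter n a p.2)| <= C * c ^+ n.
  by exists C => // n; rewrite iterE /T big_map; exact: TC.
elim: (s) => [|[v k] s' [C C0 IH]].
  by exists 0 => // n; rewrite big_nil normr0 mul0r.
have [b b0 vb] := bop_bound (adj (val v)).
exists (b * `|k| + C) => [|n]; first by rewrite addr_ge0// mulr_ge0.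
rewrite big_cons mulrDl (le_trans (ler_normD _ _))// lerD//=.
rewrite (le_trans (vb _))// -mulrA ler_wpM2l// mulrC; exact: iter_le.
Qed.

(* For a = y* y the norms r_n = |T (a^n s)| satisfy r_(n+1)^2 <= r_n r_(n+2)
   and are at most C c^n with C depending on s; log-convexity removes C. *)
Let T_le y (c : CC R) s : vN_set N y -> 0 <= c ->
  (forall k, `|(adj y \ob y) k| <= c * `|k|) ->
  `|T (act y s)| ^+ 2 <= c * `|T s| ^+ 2.
Proof.
move=> Ny c0 yc; set a := adj y \ob y; have Na : vN_set N a.
  exact: vN_mulP (vN_adjP Ny) Ny.
have aa : adj a = a by rewrite /a adj_comp adjK.
pose r n : CC R := `|T (iter n (act a) s)|.
have [C C0 rC] := T_growth s c0 yc.
have T_mid n : inner (T (iter n.+1 (act a) s)) (T (iter n.+1 (act a) s)) =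
    inner (T (iter n (act a) s)) (T (iter n.+2 (act a) s)).
  by have := T_adj (iter n (act a) s) (iter n.+1 (act a) s) Na; rewrite aa.
have r1 : r 1%N <= c * r 0%N.
  apply: log_convex_growth c0 C0 _ rC => n; first exact: normr_ge0.
  rewrite /r -inner_norm T_mid -(ger0_norm (_ : 0 <= inner _ _)).
    exact: inner_normM.
  by rewrite -T_mid.
rewrite -inner_norm T_adj// act_comp -(ger0_norm (_ : 0 <= inner _ _)); last first.
  by rewrite -act_comp -T_adj.
apply: le_trans (inner_normM _ _) _.
by rewrite expr2 mulrCA ler_wpM2l.
Qed.

Let T_lin a s t : exists u, forall z,
  T (act z u) = a *: T (act z s) + T (act z t).
Proof.
exists (act (a *: bop_id K) s ++ t) => z.
rewrite /act map_cat /T big_cat !big_map /= scaler_sumr; congr (_ + _).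
by apply: eq_bigr => q _; rewrite !bopZ.
Qed.

Let act1 s : act (bop_id K) s = s.
Proof. by rewrite /act -[RHS]map_id; apply: eq_map => -[]. Qed.

Let T_single v k : W v -> exists s, forall z, T (act z s) = adj v (z k).
Proof.
move=> Wv; exists [:: (SigSub (mem_set Wv), k)] => z.
by rewrite /T /act big_seq1.
Qed.

Let T_perp h : (forall v, W v -> v h = 0) -> forall s, inner (T s) h = 0.
Proof.
move=> Wh s; rewrite /T linear_sumlz big1// => -[v k] _ /=.
by rewrite adjP adjK Wh ?inner0r//; exact: set_valP.
Qed.

(** The assignment v* k |-> v* y k is well defined and bounded on the span of
    W* K by [T_le].  For b in M' the operators x b and b x agree on W* K and on
    the common kernel of W, since W b* is contained in W; hence x lies in M. *)
Lemma relation_symbol y : vN_set N y -> exists x, [/\ vN_set M x,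
  forall v, W v -> x \ob adj v = adj v \ob y &
  forall h, (forall v, W v -> v h = 0) -> x h = 0].
Proof.
move=> Ny; have [c c0 yc] := bop_bound (adj y \ob y).
(* 1 + c serves as an upper bound for the square root of c. *)
have bnd s : `|T (act y s)| <= (1 + c) * `|T s|.
  rewrite -(@ler_pXn2r _ 2)// ?nnegrE ?mulr_ge0 ?addr_ge0// exprMn.
  apply: le_trans (T_le s Ny c0 yc) _; rewrite ler_wpM2r ?exprn_ge0//.
  rewrite -subr_ge0 (_ : _ - c = 1 + c + c ^+ 2); last by ring.
  by rewrite !addr_ge0// exprn_ge0.
have [||x [xT x_perp]] := @bop_extension R H H S T (fun s => T (act y s)) (1 + c)
    (ex_intro _ [::] I) _ _ bnd.
- by rewrite addr_ge0.
- move=> a s t; have [u uE] := T_lin a s t; exists u.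
  by have := uE (bop_id K); rewrite !act1.
have xW v : W v -> x \ob adj v = adj v \ob y.
  move=> Wv; apply: bop_ext => k; have [s sE] := T_single k Wv.
  by rewrite !bop_compE -sE -xT -[X in T X]act1 sE.
have x_ker h : (forall v, W v -> v h = 0) -> x h = 0.
  by move=> Wh; apply: x_perp; exact: T_perp.
exists x; split=> //; apply: double_commutant => b bM.
apply: (@bop_ext_star R H K H W) => [v Wv|h Wh].
  have Wvb : W (v \ob adj b) by apply: WM => //; exact: commutant_adj.
  have := xW _ Wvb; rewrite adj_comp adjK => xbv.
  by rewrite -bop_compA xbv -!bop_compA xW.
rewrite !bop_compE (x_ker h Wh) bop0 x_ker// => v Wv.
by rewrite -bop_compE (Wh _ (WM Wv bM)).
Qed.

End Construction.

(** * Exhaustion *)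

Section Exhaustion.
Context (R : realType) (H K : hilbertType R).
Variables (V : set 'B(H, K)).
Hypotheses (V_sub : subspace_set V) (V3 : ternary V).

Let contraction w := V w /\ forall h, `|w h| <= `|h|.

Let contraction0 : contraction 0.
Proof. by split=> [|h]; [have [] := V_sub|rewrite normr0]. Qed.

Let amp_contraction w g : contraction w -> `|amp w g| <= `|g|.
Proof.
move=> [_ wh]; rewrite -[leRHS]mul1r; apply: amp_le => // h.
by rewrite mul1r.
Qed.

(* The supremum over contractions need not be attained; half of it is. *)
Let near_maximal (g : l2 H) : exists w, contraction w /\
  forall w', contraction w' -> `|amp w' g| ^+ 2 <= 2 * `|amp w g| ^+ 2.
Proof.
pose q (w : set_type contraction) : CC R := - `|amp (val w) g| ^+ 2.
have q_ge w : - `|g| ^+ 2 <= q w.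
  by rewrite lerN2 ler_pXn2r ?nnegrE//; apply: amp_contraction; exact: set_valP.
have [|m [m_le m_inf]] := real_infimum
  (ex_intro _ (SigSub (mem_set contraction0)) I) _ q_ge.
  by rewrite rpredN ger0_real// exprn_ge0.
have m_le0 : m <= 0.
  apply: le_trans (m_le (SigSub (mem_set contraction0))) _.
  by rewrite oppr_le0 exprn_ge0.
have wm w' : contraction w' -> `|amp w' g| ^+ 2 <= - m.
  by move=> w'c; rewrite lerNr; exact: m_le (SigSub (mem_set w'c)).
have [m0|m0] := eqVneq m 0.
  exists 0; split=> // w' /wm; rewrite m0 oppr0 => h; apply: le_trans h _.
  by rewrite mulr_ge0// exprn_ge0.
have [|w wq] := m_inf (- m / 2).
  by rewrite divr_gt0// oppr_gt0 lt_neqAle m0.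
exists (val w); split=> [|w' /wm h]; first exact: set_valP.
apply: le_trans h _; rewrite -ler_pdivrMl// -lerN2; apply: ltW.
by apply: lt_le_trans wq _; rewrite le_eqVlt; apply/orP; left; apply/eqP; field.
Qed.

(* The invariant of the remainders r_n of the exhaustion. *)
Let admissible (r : 'B(H, H)) := [/\ adj r = r,
  forall h, 0 <= inner (r h) h, forall h, inner (r h) h <= `|h| ^+ 2 &
  forall u, V u -> V (u \ob r)].

(* r^2 <= r for 0 <= r <= 1: positivity of r at h - r h, and r <= 1 at r h. *)
Let admissible_sq r h : admissible r -> `|r h| ^+ 2 <= inner (r h) h.
Proof.
move=> [r_adj r_ge0 r_le _]; have := r_ge0 (h - r h).
have rr : inner (r (r h)) h = inner (r h) (r h) by rewrite adjP r_adj.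
have -> : inner (r (h - r h)) (h - r h) =
    inner (r h) h - inner (r h) (r h) *+ 2 + inner (r (r h)) (r h).
  by rewrite bopB innerBl 2!linearBr /= rr; ring.
rewrite inner_norm => h1; have := le_trans h1 (lerD (lexx _) (r_le (r h))).
by rewrite mulr2n opprD addrA subrK subr_ge0.
Qed.

Let admissible_step r w : admissible r -> contraction w ->
  admissible (r - adj (w \ob r) \ob (w \ob r)).
Proof.
move=> r_adm [Vw w_le]; have [r_adj r_ge0 r_le Vr] := r_adm.
set v := w \ob r; have Vv : V v by exact: Vr.
have r'E h : inner ((r - adj v \ob v) h) h = inner (r h) h - `|v h| ^+ 2.
  by rewrite bopBE innerBl bop_compE -adjPr inner_norm.
split=> [|h|h|u Vu].
- rewrite -[r - _]addr0 -scaleN1r addrAC addr0 addrC adj_linear adj_comp adjK.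
  by rewrite r_adj rmorphN rmorph1 addrC scaleN1r.
- rewrite r'E subr_ge0; apply: le_trans (admissible_sq h r_adm).
  by rewrite ler_pXn2r ?nnegrE// /v bop_compE.
- by rewrite r'E (le_trans _ (r_le h))// gerBl exprn_ge0.
have -> : u \ob (r - adj v \ob v) = -1 *: (u \ob adj v \ob v) + u \ob r.
  by apply: bop_ext => h; rewrite bopZDE !bop_compE bopBE bopB scaleN1r addrC.
have [_ Vlin] := V_sub.
by apply: Vlin; [exact: V3|exact: Vr].
Qed.

Let admissible_amp r xi : admissible r -> `|amp r xi| <= `|xi|.
Proof.
move=> r_adm; rewrite -[leRHS]mul1r; apply: amp_le => // h; rewrite mul1r.
rewrite -(@ler_pXn2r _ 2)// ?nnegrE//.
apply: le_trans (admissible_sq h r_adm) _.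
by have [_ _ ] := r_adm.
Qed.

Let admissible_inner r (xi : l2 H) : admissible r -> 0 <= inner (amp r xi) xi.
Proof.
move=> [_ r_ge0 _ _]; rewrite l2_innerE.
apply: (cvg_complex_ge0 (F := \oo)) (series_inner_cvg _ _) _.
by apply: nearW => n; rewrite /series/= sumr_ge0.
Qed.

Lemma cvg0P (C : numFieldType) (u : nat -> C) :
  u @ \oo --> (0 : C) <->
  forall e, 0 < e -> exists n0, forall n, (n0 <= n)%N -> `|u n| < e.
Proof.
split=> [u0 e e0|h].
  have /cvgrPdist_lt/(_ e e0)[n0 _ n0P] := u0.
  by exists n0 => n /n0P; rewrite /= sub0r normrN.
apply/cvgrPdist_lt => e /h[n0 n0P]; exists n0 => // n /= /n0P.
by rewrite sub0r normrN.
Qed.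

Lemma cvg0_lin (C : numFieldType) (a : C) (u v : nat -> C) :
  u @ \oo --> (0 : C) -> v @ \oo --> (0 : C) ->
  (fun n => a * u n + v n) @ \oo --> (0 : C).
Proof.
move=> u0 v0; rewrite -[X in _ --> X](addr0 0) -[X in _ --> X + _](mulr0 a).
by apply: cvgD v0; apply: cvgM u0; exact: cvg_cst.
Qed.

(** The remainders r_n = 1 - sum_(i < n) v_i* v_i are built with v_n = w r_n for
    a contraction w in V, so that r_(n+1) = r_n - r_n w* w r_n; this keeps
    0 <= r_n <= 1 without taking square roots.  Choosing the contraction w in V so that
    |w r_n xi| is nearly maximal forces w' r_n xi -> 0 for every w' in V, that
    is, r_n xi tends weakly to 0 away from the common kernel. *)
Lemma exhaustion (xi : l2 H) : exists v : nat -> 'B(H, K), [/\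
  forall i, V (v i),
  forall n, \sum_(0 <= i < n) `|amp (v i) xi| ^+ 2 <= `|xi| ^+ 2 &
  forall (eta : l2 H) (e : CC R), 0 < e ->
    (forall n h, (forall v, V v -> v h = 0) -> inner (eta n) h = 0) ->
    exists n, `|inner xi eta -
      \sum_(0 <= i < n) inner (amp (v i) xi) (amp (v i) eta)| < e].
Proof.
have [pick pickP] := choice near_maximal.
have [r [r0 rS']] : exists r : nat -> 'B(H, H), r 0%N = bop_id H /\
    forall n, r n.+1 = r n - adj (pick (amp (r n) xi) \ob r n) \ob
      (pick (amp (r n) xi) \ob r n).
  by exists (fun n => iter n (fun r => r - adj (pick (amp r xi) \ob r) \ob
    (pick (amp r xi) \ob r)) (bop_id H)).
pose w n := pick (amp (r n) xi); pose v n := w n \ob r n.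
have rS n : r n.+1 = r n - adj (v n) \ob v n by exact: rS'.
have wP n : contraction (w n) by have [] := pickP (amp (r n) xi).
have r_adm n : admissible (r n).
  elim: n => [|n IHn]; last by rewrite rS; exact: admissible_step.
  split=> [|h|h|u Vu]; rewrite r0 ?adj_id ?inner_norm ?exprn_ge0//.
  by rewrite bop_comp1.
have Vv n : V (v n) by have [_ _ _ +] := r_adm n; apply; have [] := wP n.
have v_sum n eta : \sum_(0 <= i < n) inner (amp (v i) xi) (amp (v i) eta) =
    inner xi eta - inner (amp (r n) xi) eta.
  elim: n => [|n IHn].
    rewrite big_geq// r0 amp_id; exact/esym/subrr.
  rewrite big_nat_recr// -[LHS]/(_ + _) IHn rS ampB innerBl (amp_comp (adj _)) bop_compE.
  by rewrite -adj_amp -adjPr opprB addrA addrAC.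
have v_sq n : \sum_(0 <= i < n) `|amp (v i) xi| ^+ 2 =
    `|xi| ^+ 2 - inner (amp (r n) xi) xi.
  rewrite -inner_norm -v_sum; apply: eq_bigr => i _; exact/esym/inner_norm.
have v_le n : \sum_(0 <= i < n) `|amp (v i) xi| ^+ 2 <= `|xi| ^+ 2.
  by rewrite v_sq gerBl admissible_inner.
exists v; split=> // eta e e0 eta_perp.
have v_cvg0 : (fun n => `|amp (v n) xi| ^+ 2) @ \oo --> (0 : CC R).
  apply: (@cvg_series_cvg_0 (CC R) (CC R)).
  by apply: ge0_series_cvg v_le => k; rewrite exprn_ge0.
have contr_cvg0 u : contraction u ->
    (fun n => `|amp u (amp (r n) xi)|) @ \oo --> (0 : CC R).
  move=> uc; apply/cvg0P => d d0.
  have /cvg0P/(_ (d ^+ 2 / 2)) := v_cvg0.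
  rewrite divr_gt0 ?exprn_gt0// => /(_ isT)[n0 n0P]; exists n0 => n /n0P h.
  rewrite normr_id -(@ltr_pXn2r _ 2)// ?nnegrE//; last exact: ltW.
  have [_ /(_ u uc) uw] := pickP (amp (r n) xi).
  apply: le_lt_trans uw _; rewrite mulrC -ltr_pdivlMr//.
  by rewrite ger0_norm ?exprn_ge0// in h.
have V_cvg0 u : V u -> (fun n => `|amp u (amp (r n) xi)|) @ \oo --> (0 : CC R).
  move=> Vu; have [c c0 uc] := bop_bound u.
  have d0 : 0 < c + 1 by rewrite ltr_wpDl.
  have [_ Vlin] := V_sub; have [V0 _] := V_sub.
  pose u' := (c + 1)^-1 *: u + 0.
  have u'c : contraction u'.
    split=> [|h]; first exact: Vlin.
    rewrite /u' bopZDE addr0 normrZ gtr0_norm ?invr_gt0// mulrC ler_pdivrMr//.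
    by rewrite (le_trans (uc h))// mulrC ler_wpM2l// lerDl.
  have /cvg0P u'0 := contr_cvg0 u' u'c.
  apply/cvg0P => d dpos; have [|n0 n0P] := u'0 (d / (c + 1)).
    by rewrite divr_gt0.
  exists n0 => n /n0P; rewrite /u' ampP amp0 addr0 -[(_ *: amp u) _]/(_ *: amp u _).
  rewrite !normr_id normrZ gtr0_norm ?invr_gt0// mulrC ltr_pM2r ?invr_gt0//.
have J_cvg0 j : star_span V j ->
    (fun n => inner (amp j eta) (amp (r n) xi)) @ \oo --> (0 : CC R).
  move: j; apply: star_span_ind => [|u u' Vu Vu'].
    split=> [|a x y]; rewrite /mkset.
      apply/cvg0P => d d0; exists 0%N => n _.
      by rewrite amp0 -[(0 : 'B(l2 H, l2 H)) eta]/0 inner0l normr0.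
    move=> x0 y0.
    have -> : (fun n => inner (amp (a *: x + y) eta) (amp (r n) xi)) = (fun n =>
        a * inner (amp x eta) (amp (r n) xi) + inner (amp y eta) (amp (r n) xi)).
      by apply/funext => n; rewrite ampP bopZDE innerPl.
    exact: cvg0_lin.
  apply/cvg0P => d d0; have c0 : 0 < `|amp u' eta| + 1 by rewrite ltr_wpDl.
  have /cvg0P/(_ (d / (`|amp u' eta| + 1))) := V_cvg0 u Vu.
  rewrite divr_gt0// => /(_ isT)[n0 n0P]; exists n0 => n /n0P.
  rewrite normr_id ltr_pdivlMr// => h.
  rewrite amp_comp bop_compE -adj_amp -adjPr.
  apply: le_lt_trans (inner_normM _ _) _; apply: le_lt_trans h.
  by rewrite mulrC ler_wpM2l// lerDl.
have xi1 : 0 < `|xi| + 1 by rewrite ltr_wpDl.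
have e2 : 0 < e / 2 by rewrite divr_gt0.
have [|j Vj je] := @star_span_approx R H K V eta (e / 2 / (`|xi| + 1)) V3 eta_perp.
  by rewrite divr_gt0.
have /cvg0P/(_ _ e2)[n /(_ n (leqnn n)) nP] := J_cvg0 j Vj.
exists n; rewrite v_sum subKr -norm_conjC -form_conj.
have -> : inner eta (amp (r n) xi) =
    inner (amp j eta) (amp (r n) xi) - inner (amp j eta - eta) (amp (r n) xi).
  by rewrite innerBl subKr.
apply: le_lt_trans (ler_normB _ _) _; rewrite [ltRHS]splitr; apply: ltr_leD nP _.
apply: le_trans (inner_normM _ _) _.
apply: (@le_trans _ _ (e / 2 / (`|xi| + 1) * (`|xi| + 1))); last first.
  by rewrite divfK// gt_eqF.
apply: ler_pM => //; first exact: ltW.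
by apply: le_trans (admissible_amp xi (r_adm n)) _; rewrite lerDl.
Qed.

End Exhaustion.

(** * The bijection *)

Section RelationHom.
Context (R : realType) (H K : hilbertType R).
Context (M : vonNeumannAlgebra H) (N : vonNeumannAlgebra K).

Lemma commutant_id (L : hilbertType R) (A : set 'B(L, L)) :
  commutant A (bop_id L).
Proof. by move=> a _; rewrite bop_1comp bop_comp1. Qed.

Lemma relation_Nl (V : set 'B(H, K)) a v :
  quantum_relation M N V -> commutant N a -> V v -> V (a \ob v).
Proof.
move=> [_ _ Vab] aN Vv.
by have := Vab _ _ _ aN Vv (@commutant_id H M); rewrite bop_comp1.
Qed.

Lemma relation_Mr (V : set 'B(H, K)) v b :
  quantum_relation M N V -> V v -> commutant M b -> V (v \ob b).
Proof.
move=> [_ _ Vab] Vv bM.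
by have := Vab _ _ _ (@commutant_id K N) Vv bM; rewrite bop_1comp.
Qed.

Lemma coinjective_product (V : set 'B(H, K)) u v :
  coinjective N V -> V u -> V v -> commutant N (u \ob adj v).
Proof. by move=> Vc Vu Vv; apply: Vc; apply: qcomp_product => //; exists v. Qed.

Lemma coinjective_ternary (V : set 'B(H, K)) :
  quantum_relation M N V -> coinjective N V -> ternary V.
Proof.
move=> Vq Vc u v w Vu Vv Vw; apply: relation_Nl => //.
exact: (coinjective_product Vc Vu Vv).
Qed.

Variable V : set 'B(H, K).
Hypotheses (Vq : quantum_relation M N V) (Vc : coinjective N V).

Variable theta : N -> M.
Hypothesis theta_symbol : forall (y : N) v, V v ->
  val (theta y) \ob adj v = adj v \ob val y.
Hypothesis theta_ker : forall (y : N) h, (forall v, V v -> v h = 0) ->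
  val (theta y) h = 0.

Let V3 : ternary V. Proof. exact: coinjective_ternary. Qed.

Let V_sub : subspace_set V. Proof. by have [] := Vq. Qed.

(* Against u* with u in V: y v u* = v u* y = v theta(y) u*. *)
Let V_intertwines (y : N) v : V v -> val y \ob v = v \ob val (theta y).
Proof.
move=> Vv; apply: (@bop_ext_star R H K K V) => [u Vu|h Vh].
  rewrite -!bop_compA theta_symbol// !bop_compA.
  by rewrite -bop_compA (coinjective_product Vc Vv Vu (vN_in y)).
by rewrite !bop_compE (Vh _ Vv) theta_ker// !bop0.
Qed.

Let adj_ker (y : N) h : (forall v, V v -> v h = 0) ->
  adj (val (theta y)) h = 0.
Proof.
move=> Vh; set g := adj _ h.
have Vg v : V v -> v g = 0.
  move=> Vv; apply: inner_ext => k; rewrite inner0l adjP /g adjP adjK.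
  by rewrite -bop_compE theta_symbol// bop_compE -adjP Vh// inner0l.
by apply: inner_eq0; rewrite -adjP theta_ker// inner0l.
Qed.

Let theta_adj (y z : N) : val z = adj (val y) ->
  val (theta z) = adj (val (theta y)).
Proof.
move=> zE; apply: (@bop_ext_star R H K H V) => [v Vv|h Vh].
  by rewrite theta_symbol// zE -!adj_comp V_intertwines.
by rewrite theta_ker// adj_ker.
Qed.

Let theta_mul (x y z : N) : val z = val x \ob val y ->
  val (theta z) = val (theta x) \ob val (theta y).
Proof.
move=> zE; apply: (@bop_ext_star R H K H V) => [v Vv|h Vh].
  by rewrite -bop_compA !theta_symbol// bop_compA theta_symbol// zE bop_compA.
by rewrite bop_compE (theta_ker z Vh) (theta_ker y Vh) bop0.
Qed.

Let theta_lin a (x y z : N) : val z = a *: val x + val y ->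
  val (theta z) = a *: val (theta x) + val (theta y).
Proof.
move=> zE; apply: (@bop_ext_star R H K H V) => [v Vv|h Vh].
  by rewrite bop_compPl !theta_symbol// zE bop_compPr.
by rewrite bopZDE (theta_ker z Vh) (theta_ker x Vh) (theta_ker y Vh) scaler0 addr0.
Qed.

(* <xi, theta(y* y) xi> is the sum of <v_i xi, v_i theta(y* y) xi>, and
   v_i theta(y* y) = y* y v_i. *)
Let theta_dominated (xi : l2 H) : exists zeta : l2 K,
  forall y, `|amp (val (theta y)) xi| <= `|amp (val y) zeta|.
Proof.
have [v [Vv v_le v_exh]] := exhaustion V_sub V3 xi.
have [zeta zetaP] := l2_concat v_le.
exists zeta => y; rewrite -(@ler_pXn2r _ 2)// ?nnegrE//.
have [w wE] := vN_ex (vN_adjP (vN_in y)).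
have [z zE] := vN_ex (vN_mulP (vN_in w) (vN_in y)).
have tz : val (theta z) = adj (val (theta y)) \ob val (theta y).
  by rewrite (theta_mul zE) (theta_adj wE).
apply: (@small_le _ _ _ 1); [by rewrite ger0_real ?exprn_ge0..|].
move=> e e0; have [|n] := v_exh (amp (val (theta z)) xi) e e0.
  by move=> n h Vh; rewrite ampE adjP adj_ker// inner0r.
have -> : inner xi (amp (val (theta z)) xi) = `|amp (val (theta y)) xi| ^+ 2.
  by rewrite tz amp_comp bop_compE -adj_amp -adjP inner_norm.
have -> : \sum_(0 <= i < n) inner (amp (v i) xi) (amp (v i) (amp (val (theta z)) xi)) =
    \sum_(0 <= i < n) `|amp (val y) (amp (v i) xi)| ^+ 2.
  apply: eq_bigr => i _; rewrite -(bop_compE (amp (v i))) -amp_comp.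
  rewrite -V_intertwines// zE wE 2!amp_comp !bop_compE -adj_amp -adjP.
  exact: inner_norm.
set a := `|_| ^+ 2; set b := \sum_(_ <= _ < _) _ => ab.
have a_real : a \is Num.real by rewrite ger0_real// exprn_ge0.
have b_real : b \is Num.real.
  by rewrite ger0_real// sumr_ge0// => i _; rewrite exprn_ge0.
rewrite mulr1 -[a](subrK b) addrC lerD//; first exact: zetaP.
by apply: le_trans (ltW ab); rewrite real_ler_norm// rpredB.
Qed.

Lemma symbol_normal : normal_star_hom theta.
Proof.
split=> [a x y|x y|x|].
- by apply: val_inj; exact: theta_lin.
- by apply: val_inj; exact: theta_mul.
- by apply: val_inj; exact: theta_adj.
- exact: normal_continuous theta_lin theta_dominated.
Qed.

(** If x intertwines, then x = x p with p = theta(1), and x j p lies in V for j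
    in span (V* V) because x v* lies in N'.  Choosing j close to 1 on the range
    of p exhibits x as a limit of elements of V. *)
Lemma symbol_intertwiners : intertwiners theta = V.
Proof.
have t_hom := symbol_normal.
have V_int v : V v -> intertwiners theta v by move=> Vv y; exact: V_intertwines.
apply/seteqP; split=> [x xt|v]; last exact: V_int.
have [_ V_closed _] := Vq; apply: V_closed.
set p := val (theta (vN_id N)).
apply: closure_ultrastrong => zeta e e0; have [c c0 xc] := bop_bound x.
have c1 : 0 < c + 1 by rewrite ltr_wpDl.
have [||j Vj je] := @star_span_approx R H K V (amp p zeta) (e / (c + 1)) V3.
- by move=> n h Vh; rewrite ampE adjP adj_ker// inner0r.
- by rewrite divr_gt0.
exists (x \ob j \ob p).
  move: j Vj {je}; apply: star_span_ind => [|v w Vv Vw]; rewrite /mkset.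
    have [V0 Vlin] := V_sub; split=> [|a y z Vy Vz]; rewrite /mkset.
      by rewrite bop_comp0 bop_0comp.
    by rewrite bop_compPr bop_compPl; exact: Vlin.
  rewrite bop_compA -bop_compA (intertwiner_1 (V_int _ Vw)).
  apply: relation_Nl => //; apply: intertwiners_coinjective t_hom _ _.
  by apply: qcomp_product => //; exists v => //; exact: V_int.
have -> : amp (x \ob j \ob p - x) zeta = amp x (amp j (amp p zeta) - amp p zeta).
  rewrite bopB -2!(bop_compE (amp _)) -!amp_comp ampB.
  by rewrite (intertwiner_1 xt) (amp_comp _ p).
apply: le_lt_trans (amp_le c0 xc _) _.
by rewrite (@le_lt_trans _ _ ((c + 1) * `|amp j (amp p zeta) - amp p zeta|))
  ?ler_wpM2r ?lerDl// mulrC -ltr_pdivlMr.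
Qed.

End RelationHom.

Section Bijection.
Context (R : realType) (H K : hilbertType R).
Context (M : vonNeumannAlgebra H) (N : vonNeumannAlgebra K).

Lemma relation_hom (V : set 'B(H, K)) :
  quantum_relation M N V -> coinjective N V ->
  exists2 theta : N -> M, normal_star_hom theta & intertwiners theta = V.
Proof.
move=> Vq Vc.
have symbol (y : N) : exists m : M,
    (forall v, V v -> val m \ob adj v = adj v \ob val y) /\
    (forall h, (forall v, V v -> v h = 0) -> val m h = 0).
  have [x [Mx xV xN]] := relation_symbol
    (fun u v => @coinjective_product R H K N V u v Vc)
    (fun v b => @relation_Mr R H K M N V v b Vq) (vN_in y).
  by have [m mE] := vN_ex Mx; exists m; rewrite mE.
have [theta thetaP] := choice symbol.
have t_sym y := (thetaP y).1; have t_ker y := (thetaP y).2.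
exists theta; first exact: (@symbol_normal R H K M N V Vq Vc theta t_sym t_ker).
exact: (@symbol_intertwiners R H K M N V Vq Vc theta t_sym t_ker).
Qed.

Lemma intertwiners_bij :
  set_bij (@normal_star_hom R H K N M)
    [set V | quantum_relation M N V /\ coinjective N V]
    (@intertwiners R H K M N).
Proof.
split=> [theta t_hom|theta theta' /set_mem t_hom /set_mem t_hom'|V [Vq Vc]].
- by split; [exact: intertwiners_relation|exact: intertwiners_coinjective].
- exact: intertwiners_inj.
- by have [theta t_hom tV] := relation_hom Vq Vc; exists theta.
Qed.

End Bijection.

(** * Unital, injective and surjective homomorphisms *)

Section Properties.
Context (R : realType).

(** The elements b j, with j an approximate unit in span (V* V), tend to b and
    lie in span (V* V) because b v* = (v b* )*. *)
Lemma star_span_dense (H K : hilbertType R) (V : set 'B(H, K)) (b : 'B(H, H)) :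
  ternary V -> (forall h, (forall v, V v -> v h = 0) -> h = 0) ->
  (forall v, V v -> V (v \ob adj b)) -> closure (star_span V) b.
Proof.
move=> V3 V0 Vb; apply: closure_ultrastrong => zeta e e0.
have [c c0 bc] := bop_bound b.
have c1 : 0 < c + 1 by rewrite ltr_wpDl.
have [||j Vj je] := @star_span_approx R H K V zeta (e / (c + 1)) V3.
- by move=> n h /V0 ->; rewrite inner0r.
- by rewrite divr_gt0.
exists (b \ob j).
  have [s0 slin] := bop_span_subspace (products (qadj V) V).
  move: j Vj {je}; apply: star_span_ind => [|v w Vv Vw]; rewrite /mkset.
    split=> [|a x y Vx Vy]; rewrite /mkset; first by rewrite bop_comp0; exact: s0.
    by rewrite bop_compPr; exact: slin.
  have -> : b \ob (adj v \ob w) = adj (v \ob adj b) \ob w.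
    by rewrite adj_comp adjK bop_compA.
  by apply: star_span_product => //; exact: Vb.
have -> : amp (b \ob j - b) zeta = amp b (amp j zeta - zeta).
  by rewrite bopB ampB (amp_comp b).
apply: le_lt_trans (amp_le c0 bc _) _.
by rewrite (@le_lt_trans _ _ ((c + 1) * `|amp j zeta - zeta|))
  ?ler_wpM2r ?lerDl// mulrC -ltr_pdivlMr.
Qed.

Context (H K : hilbertType R) (M : vonNeumannAlgebra H) (N : vonNeumannAlgebra K).
Variable theta : N -> M.
Hypothesis t_hom : normal_star_hom theta.

Let p : 'B(H, H) := val (theta (vN_id N)).
Let V := intertwiners theta.

Let Vq : quantum_relation M N V. Proof. exact: intertwiners_relation. Qed.
Let V3 : ternary V. Proof. exact: intertwiners_ternary. Qed.

Lemma unitalP : unital theta <-> p = bop_id H.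
Proof.
by split=> [t1|p1]; [rewrite /p [theta _]t1|exact: val_inj].
Qed.

(** If p = theta(1) is 1, then V has no common kernel and is stable under M'.
    Conversely w p = w for w in V, an equation that extends to the weak* closure
    of span (V* V), which contains 1. *)
Lemma unital_quantum_function : unital theta <-> quantum_function M N V.
Proof.
split=> [/unitalP p1|[_ _ Vcos]].
  split=> //; first exact: intertwiners_coinjective.
  move=> b bM; apply: star_span_dense => // [h Vh|v Vv].
    by rewrite -[h]/(bop_id H h) -p1 (intertwiners_separate t_hom Vh).
  by apply: relation_Mr Vq Vv _; exact: commutant_adj.
apply/unitalP; have /Vcos : commutant M (bop_id H) by exact: commutant_id.
move=> id_cl.
suff : bop_id H \ob bop_id H = bop_id H \ob p by rewrite !bop_1comp.
apply: closure_intertwine id_cl.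
apply: (@star_span_ind R H K V [set x | bop_id H \ob x = x \ob p]) =>
  [|v w Vv Vw].
  split=> [|a x y xp yp]; rewrite /mkset; first by rewrite bop_comp0 bop_0comp.
  by rewrite bop_compPr bop_compPl xp yp.
by rewrite /mkset bop_1comp -bop_compA (intertwiner_1 Vw).
Qed.

(** The common kernel D of V* is stable under N', so its projection P lies in N;
    P v = 0 for v in V means v theta(P) = 0, so theta(P) = 0.  Injectivity
    removes the common kernel, and [star_span_dense] applies to V*.  Conversely
    y annihilates V V*, whose closed span contains 1, when theta(y) = 0. *)
Lemma injective_qsurjective : injective theta <-> qsurjective N V.
Proof.
split=> [t_inj b bN|V_surj y y' tyy'].
  rewrite /qcomp -{1}(qadjK V); apply: (@star_span_dense K H (qadj V)) => //.
  - exact: ternary_qadj.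
  - pose D := [set k | forall v, V v -> adj v k = 0].
    have D_lin : linear_subspace D.
      split=> [v _|a k l Dk Dl v Vv]; first by rewrite bop0.
      by rewrite bop_linear Dk// Dl// scaler0 addr0.
    have [P [P_D PD Pperp]] := orth_proj_exists D_lin.
    have D_N c k : commutant N c -> D k -> D (c k).
      move=> cN Dk v Vv; have Vcv : V (adj c \ob v).
        by apply: relation_Nl Vq _ Vv; exact: commutant_adj.
      by have := Dk _ Vcv; rewrite adj_comp adjK.
    have NP : vN_set N P.
      apply: double_commutant => c cN.
      apply: proj_commute PD Pperp _ _ => k Dk; first exact: D_N.
      by apply: D_N => //; exact: commutant_adj.
    have Pv v h : V v -> P (v h) = 0.
      by move=> Vv; apply: Pperp => k Dk; rewrite adjPr Dk// inner0l.
    have [y yP] := vN_ex NP; have [zer zerE] := vN_ex (vN0 N).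
    have ty h : val (theta y) h = 0.
      have := @intertwiners_separate _ _ _ _ _ _ t_hom (val (theta y) h).
      rewrite -bop_compE (hom_1l t_hom); apply=> v Vv.
      by rewrite -bop_compE -(Vv y) yP bop_compE Pv.
    have y0 : y = zer.
      apply: t_inj; apply: val_inj; apply: bop_ext => h.
      by rewrite ty (hom0 t_hom zerE).
    move=> k Dk; have <- : P k = k.
      by apply: PD => v Vv; apply: Dk; exact: qadj_in.
    by rewrite -yP y0 zerE.
  - move=> _ [v Vv <-]; rewrite -adj_comp; apply: qadj_in.
    exact: relation_Nl Vq bN Vv.
have [z zE] := vN_ex (vN_linP (-1) (vN_in y') (vN_in y)).
have tz : val (theta z) = 0.
  by rewrite (hom_lin t_hom zE) tyy' scaleN1r addNr.
have : val z \ob bop_id K = bop_id K \ob 0.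
  have /V_surj id_cl : commutant N (bop_id K) by exact: commutant_id.
  apply: closure_intertwine id_cl.
  apply: (@bop_span_ind R K K _ [set x | val z \ob x = x \ob 0]).
    split=> [|a x x' x0 x'0]; rewrite /mkset; first by rewrite !bop_comp0.
    by rewrite bop_compPr bop_compPl x0 x'0.
  move=> _ [v Vv [w Ww <-]]; rewrite /mkset.
  by rewrite bop_compA (Vv z) tz !bop_comp0 bop_0comp.
rewrite bop_comp1 bop_comp0 zE scaleN1r addrC => /subr0_eq.
exact: val_inj.
Qed.

(** If V* V lies in M', then so does its limit p = theta(1), and V* has a symbol:
    for m in M some y in N satisfies y v = v m for v in V.  Hence
    v (theta(y) - p m) = 0, and theta(y) = p m since V separates the range of p.
    Conversely, for b in M and theta(y) = p b the elements of V satisfy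
    w b = y w and v* y = theta(y) v* = b v*, so v* w commutes with b. *)
Lemma qinjectiveP : qinjective M V <->
  commutant M p /\
  range theta = [set vN_mul (theta (vN_id N)) m | m in [set: M]].
Proof.
split=> [V_inj|[pM t_range]].
  have VM v w : V v -> V w -> commutant M (adj v \ob w).
    by move=> Vv Vw; apply: V_inj; apply: qcomp_product => //; exact: qadj_in.
  split.
    apply: commutant_closed; apply: closure_ultrastrong => zeta e e0.
    have [n h Vh|j Vj je] := @star_span_approx R H K V (amp p zeta) e V3 _ e0.
      by rewrite ampE adjP (hom_1adj t_hom) (intertwiners_separate t_hom Vh) inner0r.
    exists j; first by apply: star_span_ind Vj => //; exact: commutant_subspace.
    have jp : j \ob p = j.
      apply: (@star_span_ind R H K V [set j | j \ob p = j]) Vj => [|v w Vv Vw];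
        rewrite /mkset; last first.
        by rewrite -bop_compA (intertwiner_1 Vw).
      split=> [|a x y xp yp]; rewrite /mkset; first by rewrite bop_0comp.
      by rewrite bop_compPl xp yp.
    by rewrite ampB -{1}jp amp_comp bop_compE.
  apply/seteqP; split=> [_ [y _ <-]|_ [m _ <-]].
    by exists (theta y) => //; apply: val_inj; exact: hom_1l.
  have [||x [Nx xV _]] := @relation_symbol R K H N M (qadj V) _ _ (val m) (vN_in m).
  - by move=> _ _ [v Vv <-] [w Vw <-]; rewrite adjK; exact: VM.
  - move=> _ b [v Vv <-] bN; exists (adj b \ob v).
      by apply: relation_Nl Vq _ Vv; exact: commutant_adj.
    by rewrite adj_comp adjK.
  have [y yE] := vN_ex Nx; exists y => //; apply: val_inj; apply: bop_ext => h.
  rewrite -(hom_1l t_hom) [RHS]bop_compE bop_compE.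
  apply/eqP; rewrite -subr_eq0 -bopB; apply/eqP.
  apply: (intertwiners_separate t_hom) => v Vv.
  rewrite bopB -bop_compE -(Vv y) yE.
  by have := xV _ (qadj_in Vv); rewrite adjK => ->; rewrite subrr.
apply: qcomp_sub; [exact: commutant_subspace|exact: commutant_closed|].
move=> _ w [v Vv <-] Vw b Mb; have [m mE] := vN_ex Mb.
have [y _ ty] : range theta (vN_mul (theta (vN_id N)) m).
  by rewrite t_range; exists m.
have {}ty : val (theta y) = p \ob b by rewrite ty -mE.
have wb : w \ob b = val y \ob w by rewrite (Vw y) ty bop_compA (intertwiner_1 Vw).
rewrite -bop_compA wb bop_compA -(intertwiner_adj t_hom _ Vv) ty (pM _ Mb).
by rewrite -(bop_compA b) (intertwiner_1adj t_hom Vv) bop_compA.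
Qed.

End Properties.

Theorem theorem3p12 (R : realType) (H K : hilbertType R)
    (M : vonNeumannAlgebra H) (N : vonNeumannAlgebra K) :
  [/\ set_bij (@normal_star_hom R H K N M)
        [set V | quantum_relation M N V /\ coinjective N V]
        (@intertwiners R H K M N),
      forall theta : N -> M, normal_star_hom theta ->
        (unital theta <-> quantum_function M N (intertwiners theta)),
      forall theta : N -> M, normal_star_hom theta ->
        (injective theta <-> qsurjective N (intertwiners theta)),
      forall theta : N -> M, normal_star_hom theta ->
        (qinjective M (intertwiners theta) <->
         commutant M (\val (theta (vN_id N))) /\
         range theta = [set vN_mul (theta (vN_id N)) m | m in [set: M]]) &
      forall theta : N -> M, normal_star_hom theta ->
        quantum_function M N (intertwiners theta) ->
        (range theta = setT <-> qinjective M (intertwiners theta))].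
Proof.
split=> [|theta t_hom|theta t_hom|theta t_hom|theta t_hom t_qf].
- exact: intertwiners_bij.
- exact: unital_quantum_function.
- exact: injective_qsurjective.
- exact: qinjectiveP.
have t1 : theta (vN_id N) = vN_id M.
  exact: (unital_quantum_function t_hom).2.
have t1M : commutant M (\val (theta (vN_id N))).
  by rewrite t1; exact: commutant_id.
have -> : [set: M] = [set vN_mul (theta (vN_id N)) m | m in [set: M]].
  apply/seteqP; split=> // m _; exists m => //.
  by rewrite t1; apply: val_inj; exact: bop_1comp.
by split=> [t_onto|/(qinjectiveP t_hom)[]//]; apply/(qinjectiveP t_hom).
Qed.
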